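(* Let $J$ be an $m\times m$ matrix with $J=J^*=J^{-1}$. Let a real-valued scalar function $\alpha(\xi,\eta)$ and an $m\times m$ invertible complex matrix function $u(\xi,\eta)$ satisfy $$\big(\alpha u_{\xi}u^{-1}\big)_{\eta}+\big(\alpha u_{\eta}u^{-1}\big)_{\xi}=0,\qquad \alpha_{\xi\eta}=0, \qquad u(0,0)=I_m,$$ and put $$q:=u_{\xi}u^{-1},\qquad Q:=-u_{\eta}u^{-1}.$$ Assume that $qJ=-Jq^*$ and $QJ=-JQ^*$. Let $\mathcal{A}$ and $S(0,0)$ be $n\times n$ complex matrices and $\Pi(0,0)$ an $n\times m$ complex matrix such that $$S(0,0)=S(0,0)^*,\qquad \mathcal{A}S(0,0)-S(0,0)\mathcal{A}^*=\mathrm{i}\,\Pi(0,0)J\Pi(0,0)^*.$$ Let the matrix functions $A(\xi,\eta)$, $\Pi(\xi,\eta)$, $S(\xi,\eta)$ be determined by $A(0,0)=\mathcal{A}$, by the values $\Pi(0,0)$, $S(0,0)$, and by the equations $$A_{\xi}=-\frac{\alpha_{\xi}}{\alpha}A-\frac{2\alpha_{\xi}}{\alpha}I_n-\frac{2\alpha_{\xi}}{\alpha}(A-I_n)^{-1},\qquad A_{\eta}=-\frac{\alpha_{\eta}}{\alpha}A+\frac{2\alpha_{\eta}}{\alpha}I_n-\frac{2\alpha_{\eta}}{\alpha}(A+I_n)^{-1},$$ $$\Pi_{\xi}=(A-I_n)^{-1}\Pi q,\qquad \Pi_{\eta}=(A+I_n)^{-1}\Pi Q,$$ $$S_{\xi}=\frac{\alpha_{\xi}}{\alpha}\Big(S-2(A-I_n)^{-1}S(A^*-I_n)^{-1}\Big)-\mathrm{i}(A-I_n)^{-1}\Pi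 qJ\Pi^*(A^*-I_n)^{-1},$$ $$S_{\eta}=\frac{\alpha_{\eta}}{\alpha}\Big(S-2(A+I_n)^{-1}S(A^*+I_n)^{-1}\Big)-\mathrm{i}(A+I_n)^{-1}\Pi QJ\Pi^*(A^*+I_n)^{-1}.$$ Set $$\mathcal{U}(\xi,\eta):=I_m-\mathrm{i}J\Pi(\xi,\eta)^*S(\xi,\eta)^{-1}A(\xi,\eta)^{-1}\Pi(\xi,\eta),\qquad \widehat{u}(\xi,\eta):=\mathcal{U}(\xi,\eta)u(\xi,\eta).$$ Then $\alpha$ and $\widehat{u}$ satisfy the same equation, that is, $$\big(\alpha\,\widehat{u}_{\xi}\,\widehat{u}^{-1}\big)_{\eta}+\big(\alpha\,\widehat{u}_{\eta}\,\widehat{u}^{-1}\big)_{\xi}=0.$$ Moreover, $\widehat{u}$ is $J$-unitary: $\widehat{u}(\xi,\eta)^*J\,\widehat{u}(\xi,\eta)\equiv J$.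
   Context: Here $m,n\in\mathbb{N}$, $\mathrm{i}$ is the imaginary unit, $I_k$ is the $k\times k$ identity matrix, $M^*$ is the conjugate transpose of $M$ (and $A^*(\xi,\eta)=A(\xi,\eta)^*$), and subscripts $\xi,\eta$ denote partial derivatives. The real variables $(\xi,\eta)$ range over a connected open set (e.g. an open rectangle) $D\subset\mathbb{R}^2$ containing $(0,0)$. Standing assumptions: $\alpha(\xi,\eta)=f(\xi)+h(\eta)$ with $f,h$ real-valued and continuously differentiable (this is the meaning of $\alpha_{\xi\eta}=0$); $\alpha$ does not vanish on $D$; $q$ and $Q$ are continuously differentiable; the solutions $A,\Pi,S$ exist on $D$, with $A-I_n$ and $A+I_n$ invertible there. Formulas containing $S^{-1}$ and $A^{-1}$, and the assertions about $\mathcal{U}$ and $\widehat{u}$, are considered at the points where $S(\xi,\eta)$ and $A(\xi,\eta)$ are invertible. *)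

(* Defs.v *)
From HB Require Import structures.
From mathcomp Require Import all_boot all_order all_algebra spectral.
From mathcomp Require Import complex.
From mathcomp Require Import all_classical all_reals all_analysis.

Set Implicit Arguments.
Unset Strict Implicit.
Unset Printing Implicit Defensive.

Import Order.TTheory GRing.Theory Num.Theory.
Import numFieldNormedType.Exports.

#[global] Open Scope classical_set_scope.
#[global] Open Scope complex_scope.
#[global] Open Scope sesquilinear_scope.
#[global] Open Scope ring_scope.

(* A point p : R * R is (xi, eta). *)
Definition dir_xi {R : realType} : R * R := (1, 0).
Definition dir_eta {R : realType} : R * R := (0, 1).

(* R[i] has no normed R-module structure in the library, so matrix functions
   of real variables are differentiated on the real and imaginary parts of
   their entries.  pderive is only meaningful where pderivable holds. *)
Definition pderivable {R : realType} {k l : nat} (v : R * R)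
    (F : R * R -> 'M[R[i]]_(k, l)) (p : R * R) : Prop :=
  forall i j, derivable (fun x => complex.Re (F x i j)) p v /\
              derivable (fun x => complex.Im (F x i j)) p v.

Definition pderive {R : realType} {k l : nat} (v : R * R)
    (F : R * R -> 'M[R[i]]_(k, l)) (p : R * R) : 'M[R[i]]_(k, l) :=
  \matrix_(i, j) Complex ('D_v (fun x => complex.Re (F x i j)) p)
                         ('D_v (fun x => complex.Im (F x i j)) p).

Definition mx_continuous_at {R : realType} {k l : nat}
    (F : R * R -> 'M[R[i]]_(k, l)) (p : R * R) : Prop :=
  forall i j, {for p, continuous (fun x => complex.Re (F x i j))} /\
              {for p, continuous (fun x => complex.Im (F x i j))}.

Definition C1_on {R : realType} {k l : nat} (D : set (R * R))
    (F : R * R -> 'M[R[i]]_(k, l)) : Prop :=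
  forall p, D p ->
    [/\ pderivable dir_xi F p, pderivable dir_eta F p,
        mx_continuous_at (pderive dir_xi F) p &
        mx_continuous_at (pderive dir_eta F) p].

Definition C1_at {R : realType} (f : R -> R) (x : R) : Prop :=
  [/\ \forall y \near x, derivable f y 1 & {for x, continuous (derive1 f)}].

Definition logder {R : realType} {m : nat} (v : R * R)
    (w : R * R -> 'M[R[i]]_m) (p : R * R) : 'M[R[i]]_m :=
  pderive v w p *m invmx (w p).

(* (alpha w_xi w^-1)_eta + (alpha w_eta w^-1)_xi = 0 on G, including the
   invertibility of w and the existence of all the derivatives involved. *)
Definition satisfies_eq {R : realType} {m : nat} (G : set (R * R))
    (alpha : R * R -> R) (w : R * R -> 'M[R[i]]_m) : Prop :=
  let P := fun p => (alpha p)%:C *: logder dir_xi w p in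
  let T := fun p => (alpha p)%:C *: logder dir_eta w p in
  forall p, G p ->
    [/\ w p \in unitmx,
        pderivable dir_xi w p /\ pderivable dir_eta w p,
        pderivable dir_eta P p /\ pderivable dir_xi T p &
        pderive dir_eta P p + pderive dir_xi T p = 0].

Definition darboux {R : realType} {m n : nat} (J : 'M[R[i]]_m)
    (A : R * R -> 'M[R[i]]_n) (Pi : R * R -> 'M[R[i]]_(n, m))
    (S : R * R -> 'M[R[i]]_n) (p : R * R) : 'M[R[i]]_m :=
  1%:M - 'i *: (J *m (Pi p)^t* *m invmx (S p) *m invmx (A p) *m Pi p).

(* Main.v *)
Require Import Defs.
From HB Require Import structures.
From mathcomp Require Import all_boot all_order all_algebra spectral.
From mathcomp Require Import complex ring lra.
From mathcomp Require Import all_classical all_reals all_analysis.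
Import Order.TTheory GRing.Theory Num.Theory.
Import numFieldNormedType.Exports.

(* Write a = alpha_xi / alpha, B = (A - 1)^-1 and w(l) = 1 - i J Pi^* S^-1 (A - l)^-1 Pi,
   so that the Darboux matrix is U = w(0).

   The xi-derivative of A S - S A^* - i Pi J Pi^* vanishes identically, hence the
   identity A S - S A^* = i Pi J Pi^* propagates from the origin.  It makes the
   defect Z = S - S^* satisfy A Z = Z A^* and therefore a linear equation with an
   explicit integrating factor in A, so S stays selfadjoint.  Both facts give
   U^* J U = J, while u^* J u is constant.

   With qh = w(1) q w(1)^-1 + 2 a w'(1) w(1)^-1 one finds U_xi = qh U - U q, that
   is (U u)_xi (U u)^-1 = qh, and (alpha J Pi^* S^-1 Pi)_xi = i alpha (qh - q).
   The eta-equations are the xi-equations for (- A, - S, - Q), so the analogous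
   formulas hold in eta with the opposite sign of J Pi^* S^-1 Pi.  The equation for
   U u thus differs from the one for u by the difference of the two mixed
   derivatives of alpha J Pi^* S^-1 Pi.

   These agree by Schwarz's theorem once A, Pi and S are jointly continuous, which
   is not part of the assumptions: a solution of the xi-equation has a bounded
   velocity while it stays near its initial value, so it cannot escape quickly. *)

Set Implicit Arguments.
Unset Strict Implicit.
Unset Printing Implicit Defensive.
Local Open Scope ring_scope.

(** * Entrywise convergence and directional derivatives *)

(** On commuting scalars the equations read [A_xi = - a A (A + 1) (A - 1)^-1] and, with
    [b = alpha_eta / alpha], [A_eta = - b A (A - 1) (A + 1)^-1]. Let the spectral parameter l move
    by the same law. Both velocities vanish at 0, so l = 0 stays at rest, and [w(0)] dresses u
    itself rather than a solution depending on a moving parameter. The xi-velocity has residue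
    [- 2 a] at l = 1; comparing residues there in the dressed linear system gives
    [qh w(1) = w(1) q + 2 a w'(1)], the origin of the second term of [qh]. *)

Definition ccvg {R : realType} {T : Type} (Phi : set_system T)
    (c : T -> R[i]) (l : R[i]) : Prop :=
  (fun t => complex.Re (c t)) @ Phi --> complex.Re l /\
  (fun t => complex.Im (c t)) @ Phi --> complex.Im l.

(** The filter is left free because three kinds occur: punctured neighbourhoods of 0 for difference
    quotients, neighbourhoods of a point for joint continuity, and the trace on a graph for limits
    taken before continuity is known. *)
Definition mxcvg {R : realType} {T : Type} (Phi : set_system T) {k l : nat}
    (F : T -> 'M[R[i]]_(k, l)) (L : 'M[R[i]]_(k, l)) : Prop :=
  forall i j, ccvg Phi (fun t => F t i j) (L i j).

Section Convergence.
Context {R : realType} {T : Type} {Phi : set_system T} {FPhi : Filter Phi}.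
Implicit Types c d : T -> R[i].

Lemma near_eq_ccvg c d l : (\forall t \near Phi, c t = d t) ->
  ccvg Phi c l -> ccvg Phi d l.
Proof.
move=> cd [cr ci]; split.
- by apply: cvg_trans cr; apply: near_eq_cvg; apply: filterS cd => t ->.
- by apply: cvg_trans ci; apply: near_eq_cvg; apply: filterS cd => t ->.
Qed.

Lemma ccvg_cst (l : R[i]) : ccvg Phi (fun=> l) l.
Proof. by split; exact: cvg_cst. Qed.

Lemma ccvg_real (x : T -> R) (l : R) : x @ Phi --> l ->
  ccvg Phi (fun t => (x t)%:C) l%:C.
Proof. by move=> xl; split => //=; exact: cvg_cst. Qed.

Lemma ccvgD c d lc ld : ccvg Phi c lc -> ccvg Phi d ld ->
  ccvg Phi (fun t => c t + d t) (lc + ld).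
Proof.
case: lc ld => [? ?] [? ?] [/= cr ci] [/= dr di]; split => /=.
- under eq_fun do rewrite raddfD /=. exact: cvgD.
- under eq_fun do rewrite raddfD /=. exact: cvgD.
Qed.

Lemma ccvgN c lc : ccvg Phi c lc -> ccvg Phi (fun t => - c t) (- lc).
Proof.
case: lc => ? ? [/= cr ci]; split => /=.
- under eq_fun do rewrite raddfN /=. exact: cvgN.
- under eq_fun do rewrite raddfN /=. exact: cvgN.
Qed.

Lemma ccvgM c d lc ld : ccvg Phi c lc -> ccvg Phi d ld ->
  ccvg Phi (fun t => c t * d t) (lc * ld).
Proof.
have ReM (x y : R[i]) : complex.Re (x * y) =
  complex.Re x * complex.Re y - complex.Im x * complex.Im y by case: x y => ? ? [].
have ImM (x y : R[i]) : complex.Im (x * y) =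
  complex.Re x * complex.Im y + complex.Im x * complex.Re y by case: x y => ? ? [].
move=> [cr ci] [dr di]; split.
- rewrite ReM; under eq_fun do rewrite ReM. by apply: cvgB; apply: cvgM.
- rewrite ImM; under eq_fun do rewrite ImM. by apply: cvgD; apply: cvgM.
Qed.

Lemma ccvgV c lc : lc != 0 -> ccvg Phi c lc ->
  ccvg Phi (fun t => ((c t)^-1)%R) (lc^-1)%R.
Proof.
pose N (x : R[i]) := complex.Re x ^+ 2 + complex.Im x ^+ 2.
have ReV (x : R[i]) : complex.Re x^-1 = complex.Re x / N x by case: x.
have ImV (x : R[i]) : complex.Im x^-1 = - (complex.Im x / N x) by case: x.
move=> l0 [cr ci].
have N0 : N lc != 0.
  apply: contraNneq l0 => /eqP; rewrite /N paddr_eq0 ?sqr_ge0 // !sqrf_eq0.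
  by case: lc {cr ci} => a b /= /andP[/eqP -> /eqP ->].
have cN : (fun t => N (c t)) @ Phi --> N lc.
  by apply: cvgD; rewrite expr2; under eq_fun do rewrite expr2; apply: cvgM.
split.
- rewrite ReV; under eq_fun do rewrite ReV. by apply: cvgM => //; apply: cvgV.
- rewrite ImV; under eq_fun do rewrite ImV.
  by apply: cvgN; apply: cvgM => //; apply: cvgV.
Qed.

Lemma ccvg_conj c lc : ccvg Phi c lc -> ccvg Phi (fun t => Num.conj (c t)) (Num.conj lc).
Proof.
have ReJ (x : R[i]) : complex.Re (Num.conj x) = complex.Re x by case: x.
have ImJ (x : R[i]) : complex.Im (Num.conj x) = - complex.Im x by case: x.
move=> [cr ci]; split.
- by rewrite ReJ; under eq_fun do rewrite ReJ.
- by rewrite ImJ; under eq_fun do rewrite ImJ; apply: cvgN.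
Qed.

Lemma ccvg_sum (I : Type) (r : seq I) (P : pred I) (c : I -> T -> R[i])
    (l : I -> R[i]) : (forall i, ccvg Phi (c i) (l i)) ->
  ccvg Phi (fun t => \sum_(i <- r | P i) c i t) (\sum_(i <- r | P i) l i).
Proof.
move=> cl; elim: r => [|j r IH].
  by rewrite big_nil; under eq_fun do rewrite big_nil; exact: ccvg_cst.
rewrite big_cons; under eq_fun do rewrite big_cons.
by case: (P j) => //; exact: ccvgD.
Qed.

Lemma ccvg_prod (I : Type) (r : seq I) (P : pred I) (c : I -> T -> R[i])
    (l : I -> R[i]) : (forall i, ccvg Phi (c i) (l i)) ->
  ccvg Phi (fun t => \prod_(i <- r | P i) c i t) (\prod_(i <- r | P i) l i).
Proof.
move=> cl; elim: r => [|j r IH].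
  by rewrite big_nil; under eq_fun do rewrite big_nil; exact: ccvg_cst.
rewrite big_cons; under eq_fun do rewrite big_cons.
by case: (P j) => //; exact: ccvgM.
Qed.

Lemma near_eq_mxcvg k l (F G : T -> 'M[R[i]]_(k, l)) L :
  (\forall t \near Phi, F t = G t) -> mxcvg Phi F L -> mxcvg Phi G L.
Proof.
by move=> FG FL i j; apply: near_eq_ccvg (FL i j); apply: filterS FG => t ->.
Qed.

Lemma mxcvg_cst k l (L : 'M[R[i]]_(k, l)) : mxcvg Phi (fun=> L) L.
Proof. by move=> i j; exact: ccvg_cst. Qed.

Lemma mxcvgD k l (F G : T -> 'M[R[i]]_(k, l)) L M :
  mxcvg Phi F L -> mxcvg Phi G M -> mxcvg Phi (fun t => F t + G t) (L + M).
Proof.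
move=> FL GM i j; rewrite mxE; under eq_fun do rewrite mxE.
exact: ccvgD.
Qed.

Lemma mxcvgM k l n (F : T -> 'M[R[i]]_(k, l)) (G : T -> 'M[R[i]]_(l, n)) L M :
  mxcvg Phi F L -> mxcvg Phi G M -> mxcvg Phi (fun t => F t *m G t) (L *m M).
Proof.
move=> FL GM i j; rewrite mxE; under eq_fun do rewrite mxE.
by apply: ccvg_sum => s; exact: ccvgM.
Qed.

Lemma mxcvg_scalar k c (l : R[i]) :
  ccvg Phi c l -> mxcvg Phi (fun t => (c t)%:M : 'M[R[i]]_k) l%:M.
Proof.
move=> cl i j; rewrite mxE; under eq_fun do rewrite mxE.
by case: (i == j) => //; exact: ccvg_cst.
Qed.

Lemma mxcvgZ k l c (x : R[i]) (F : T -> 'M[R[i]]_(k, l)) L :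
  ccvg Phi c x -> mxcvg Phi F L -> mxcvg Phi (fun t => c t *: F t) (x *: L).
Proof.
move=> cx FL i j; rewrite mxE; under eq_fun do rewrite mxE.
exact: ccvgM.
Qed.

Lemma mxcvgN k l (F : T -> 'M[R[i]]_(k, l)) L :
  mxcvg Phi F L -> mxcvg Phi (fun t => - F t) (- L).
Proof.
move=> FL; rewrite -scaleN1r; under eq_fun do rewrite -scaleN1r.
by apply: mxcvgZ => //; exact: ccvg_cst.
Qed.

Lemma mxcvgB k l (F G : T -> 'M[R[i]]_(k, l)) L M :
  mxcvg Phi F L -> mxcvg Phi G M -> mxcvg Phi (fun t => F t - G t) (L - M).
Proof. by move=> FL GM; apply: mxcvgD => //; exact: mxcvgN. Qed.

Lemma mxcvg_adj k l (F : T -> 'M[R[i]]_(k, l)) L :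
  mxcvg Phi F L -> mxcvg Phi (fun t => (F t)^t*) (L^t*).
Proof.
move=> FL i j; rewrite !mxE; under eq_fun do rewrite !mxE.
exact: ccvg_conj.
Qed.

Lemma ccvg_det k (F : T -> 'M[R[i]]_k) L :
  mxcvg Phi F L -> ccvg Phi (fun t => \det (F t)) (\det L).
Proof.
move=> FL; apply: ccvg_sum => s; apply: ccvgM; first exact: ccvg_cst.
exact: ccvg_prod.
Qed.

Lemma ccvg_neq0 c (l : R[i]) :
  l != 0 -> ccvg Phi c l -> \forall t \near Phi, c t != 0.
Proof.
move=> l0 [cr ci]; have [r0|r0] := eqVneq (complex.Re l) 0.
  have i0 : complex.Im l != 0.
    by apply: contraNneq l0; case: l r0 {cr ci} => a b /= -> ->.
  by apply: filterS (cvgr_neq0 _ ci i0) => t; apply: contraNneq => ->.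
by apply: filterS (cvgr_neq0 _ cr r0) => t; apply: contraNneq => ->.
Qed.

Lemma mxcvg_unit k (F : T -> 'M[R[i]]_k) L : L \in unitmx ->
  mxcvg Phi F L -> \forall t \near Phi, F t \in unitmx.
Proof.
rewrite unitmxE unitfE => L0 FL.
apply: filterS (ccvg_neq0 L0 (ccvg_det FL)) => t.
by rewrite unitmxE unitfE.
Qed.

Lemma mxcvg_inv k (F : T -> 'M[R[i]]_k) L : L \in unitmx ->
  mxcvg Phi F L -> mxcvg Phi (fun t => invmx (F t)) (invmx L).
Proof.
move=> Lu FL; have L0 := Lu; rewrite unitmxE unitfE in L0.
rewrite /invmx Lu.
(* Cramer's formula is available only where [F t] is invertible, since [invmx] returns its argument
   elsewhere. *)
apply: (@near_eq_mxcvg _ _ (fun t => ((\det (F t))^-1)%R *: \adj (F t))).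
  by apply: filterS (mxcvg_unit Lu FL) => t Ftu; rewrite /invmx Ftu.
apply: mxcvgZ; first by apply: ccvgV => //; exact: ccvg_det.
move=> i j; have adjE (M : 'M[R[i]]_k) : (\adj M) i j = cofactor M j i.
  by rewrite mxE.
rewrite adjE; apply: (@near_eq_ccvg (fun t => cofactor (F t) j i)).
  by apply: nearW => t; rewrite adjE.
apply: ccvgM; first exact: ccvg_cst.
apply: ccvg_det => a b; rewrite !mxE; under eq_fun do rewrite !mxE.
exact: FL.
Qed.

End Convergence.

Definition is_pderive {R : realType} {k l : nat} (v : R * R)
    (F : R * R -> 'M[R[i]]_(k, l)) (p : R * R) (F' : 'M[R[i]]_(k, l)) : Prop :=
  pderivable v F p /\ pderive v F p = F'.

Definition dquot {R : realType} {k l : nat} (v : R * R)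
    (F : R * R -> 'M[R[i]]_(k, l)) (p : R * R) (h : R) : 'M[R[i]]_(k, l) :=
  (h^-1)%:C *: (F (h *: v + p) - F p).

Section Derivative.
Context {R : realType}.
Implicit Types (v p : R * R).

(** Turns each rule of differentiation below into a limit rule for [dquot], handling existence and
    value of the derivative together. *)
Lemma is_pderiveP k l v (F : R * R -> 'M[R[i]]_(k, l)) p F' :
  is_pderive v F p F' <-> mxcvg 0^' (dquot v F p) F'.
Proof.
have Rq i j : (fun h : R => complex.Re (dquot v F p h i j)) =
    (fun h => h^-1 *: (((fun x => complex.Re (F x i j)) \o shift p) (h *: v)
       - complex.Re (F p i j))).
  apply/funext => h; rewrite /dquot !mxE /=.
  by case: (F _ i j) (F p i j) => ? ? [? ?] /=; rewrite mul0r subr0.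
have Iq i j : (fun h : R => complex.Im (dquot v F p h i j)) =
    (fun h => h^-1 *: (((fun x => complex.Im (F x i j)) \o shift p) (h *: v)
       - complex.Im (F p i j))).
  apply/funext => h; rewrite /dquot !mxE /=.
  by case: (F _ i j) (F p i j) => ? ? [? ?] /=; rewrite mul0r addr0.
split=> [[dF <-] i j|dF].
  have [dr di] := dF i j; split; rewrite mxE /=.
  - by rewrite Rq; exact: dr.
  - by rewrite Iq; exact: di.
have dr i j := (dF i j).1; have di i j := (dF i j).2.
split.
  move=> i j; split; apply/cvg_ex.
  - by exists (complex.Re (F' i j)); rewrite -Rq; exact: dr.
  - by exists (complex.Im (F' i j)); rewrite -Iq; exact: di.
apply/matrixP => i j; rewrite mxE /derive -Rq -Iq.
by rewrite (cvg_lim _ (dr i j)) // (cvg_lim _ (di i j)) //; case: (F' i j).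
Qed.

Lemma is_pderive_eq k l v (F : R * R -> 'M[R[i]]_(k, l)) p F' F'' :
  is_pderive v F p F' -> F' = F'' -> is_pderive v F p F''.
Proof. by move=> ? <-. Qed.

Lemma cvg_line v p : (fun h : R => h *: v + p) @ 0^' --> p.
Proof.
have : (fun h : R => h *: v + p) @ (0 : R) --> p.
  rewrite -[X in _ --> X]add0r -(scale0r v).
  by apply: cvgD; [apply: cvgZr_tmp; exact: cvg_id|exact: cvg_cst].
exact: cvg_within_filter.
Qed.

Lemma near_eq_is_pderive k l v (F G : R * R -> 'M[R[i]]_(k, l)) p F' :
  (\forall x \near p, F x = G x) -> is_pderive v F p F' -> is_pderive v G p F'.
Proof.
move=> FG /is_pderiveP dF; apply/is_pderiveP; apply: near_eq_mxcvg dF.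
have FGp := nbhs_singleton FG.
have FGl : \forall h \near 0^', F (h *: v + p) = G (h *: v + p).
  exact: (@cvg_line v p _ FG).
by apply: filterS FGl => h FGh; rewrite /dquot FGh FGp.
Qed.

(** Differentiability along v gives continuity along that line only, which is enough for the product
    and inverse rules. *)
Lemma is_pderive_cvg k l v (F : R * R -> 'M[R[i]]_(k, l)) p F' :
  is_pderive v F p F' -> mxcvg 0^' (fun h : R => F (h *: v + p)) (F p).
Proof.
move=> /is_pderiveP dF.
apply: (@near_eq_mxcvg _ _ _ _ _ _ (fun h : R => F p + h%:C *: dquot v F p h)).
  apply: filterS (nbhs_dnbhs_neq (0 : R)) => h h0.
  rewrite /dquot scalerA -rmorphM /= divff // scale1r.
  by rewrite addrC subrK.
rewrite -[X in mxcvg _ _ X]addr0 -(scale0r F').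
apply: mxcvgD; first exact: mxcvg_cst.
apply: mxcvgZ => //; apply: ccvg_real.
exact: cvg_within_filter.
Qed.

Lemma is_pderive_cst k l v p (L : 'M[R[i]]_(k, l)) :
  is_pderive v (fun=> L) p 0.
Proof.
apply/is_pderiveP; apply: (near_eq_mxcvg _ (mxcvg_cst 0)).
by apply: nearW => h; rewrite /dquot subrr scaler0.
Qed.

Lemma is_pderiveD k l v (F G : R * R -> 'M[R[i]]_(k, l)) p F' G' :
  is_pderive v F p F' -> is_pderive v G p G' ->
  is_pderive v (fun x => F x + G x) p (F' + G').
Proof.
move=> /is_pderiveP dF /is_pderiveP dG; apply/is_pderiveP.
apply: near_eq_mxcvg (mxcvgD dF dG).
by apply: nearW => h; rewrite /dquot -scalerDr opprD addrACA.
Qed.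

Lemma is_pderiveM k l n v (F : R * R -> 'M[R[i]]_(k, l))
    (G : R * R -> 'M[R[i]]_(l, n)) p F' G' :
  is_pderive v F p F' -> is_pderive v G p G' ->
  is_pderive v (fun x => F x *m G x) p (F' *m G p + F p *m G').
Proof.
move=> dF dG; apply/is_pderiveP; have cG := is_pderive_cvg dG.
have /is_pderiveP dF' := dF; have /is_pderiveP dG' := dG.
apply: near_eq_mxcvg (mxcvgD (mxcvgM dF' cG) (mxcvgM (mxcvg_cst (F p)) dG')).
by apply: nearW => h; rewrite /dquot -scalemxAl -scalemxAr -scalerDr mulmxBl mulmxBr addrA subrK //.
Qed.

Lemma is_pderiveZ k l v (c : R[i]) (F : R * R -> 'M[R[i]]_(k, l)) p F' :
  is_pderive v F p F' -> is_pderive v (fun x => c *: F x) p (c *: F').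
Proof.
move=> /is_pderiveP dF; apply/is_pderiveP.
apply: near_eq_mxcvg (mxcvgZ (ccvg_cst c) dF).
by apply: nearW => h; rewrite /dquot -scalerBr !scalerA mulrC.
Qed.

Lemma is_pderiveN k l v (F : R * R -> 'M[R[i]]_(k, l)) p F' :
  is_pderive v F p F' -> is_pderive v (fun x => - F x) p (- F').
Proof.
move=> /(is_pderiveZ (-1)); rewrite scaleN1r.
by under eq_fun do rewrite scaleN1r.
Qed.

Lemma is_pderiveB k l v (F G : R * R -> 'M[R[i]]_(k, l)) p F' G' :
  is_pderive v F p F' -> is_pderive v G p G' ->
  is_pderive v (fun x => F x - G x) p (F' - G').
Proof. by move=> dF dG; apply: is_pderiveD => //; exact: is_pderiveN. Qed.

Lemma is_pderive_adj k l v (F : R * R -> 'M[R[i]]_(k, l)) p F' :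
  is_pderive v F p F' -> is_pderive v (fun x => (F x)^t*) p (F'^t*).
Proof.
move=> /is_pderiveP dF; apply/is_pderiveP.
apply: near_eq_mxcvg (mxcvg_adj dF); apply: nearW => h.
apply/matrixP => i j; rewrite !mxE rmorphM rmorphB /=.
by congr (_ * _); exact: conjc_real.
Qed.

Lemma is_pderive_inv k v (F : R * R -> 'M[R[i]]_k) p F' : F p \in unitmx ->
  is_pderive v F p F' ->
  is_pderive v (fun x => invmx (F x)) p (- (invmx (F p) *m F' *m invmx (F p))).
Proof.
move=> Fu dF; apply/is_pderiveP; have cF := is_pderive_cvg dF.
have /is_pderiveP dF' := dF.
apply: near_eq_mxcvg (mxcvgN (mxcvgM (mxcvgM (mxcvg_inv Fu cF) dF')
  (mxcvg_cst (invmx (F p))))).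
apply: filterS (mxcvg_unit Fu cF) => h Fhu.
rewrite /dquot -scalemxAr -scalemxAl -scalerN mulmxBr mulmxBl.
by rewrite mulVmx // -!mulmxA mulmxV // mulmx1 mul1mx opprB.
Qed.

End Derivative.

(** * Real functions on the plane *)

Section Plane.
Context {R : realType}.
Implicit Types (v p x : R * R).

Lemma nbhs_boxP p (P : set (R * R)) : nbhs p P <->
  exists2 e : R, 0 < e &
    forall x, `|x.1 - p.1| < e -> `|x.2 - p.2| < e -> P x.
Proof.
split=> [/nbhs_ballP[e /= e0 eP]|[e e0 eP]].
  exists e => // x x1 x2; apply: eP; split; rewrite /ball /= distrC //.
apply/nbhs_ballP; exists e => //= x [x1 x2].
by apply: eP; rewrite distrC.
Qed.

Lemma is_derive_line v p (f : R * R -> R) (s df : R) :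
  is_derive (s *: v + p) v f df ->
  is_derive s 1 (fun t : R => f (t *: v + p)) df.
Proof.
have E : (fun h : R => h^-1 *: (((fun t : R => f (t *: v + p)) \o shift s) (h *: 1)
            - f (s *: v + p))) =
         (fun h : R => h^-1 *: ((f \o shift (s *: v + p)) (h *: v) - f (s *: v + p))).
  by apply/funext => h /=; rewrite [h *: 1]mulr1 scalerDl addrA.
by move=> [df1 df2]; split; rewrite /derivable /derive E.
Qed.

(** Hypothesis and conclusion are symmetric about 0, so that callers need not distinguish the sign
    of r. *)
Lemma mvt_line v p (f : R * R -> R) (df : R * R -> R) (r : R) :
  (forall s : R, `|s| <= `|r| ->
     is_derive (s *: v + p) v f (df (s *: v + p))) ->
  exists2 c : R, `|c| <= `|r| & f (r *: v + p) - f p = df (c *: v + p) * r.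
Proof.
move=> fd; pose g (t : R) := f (t *: v + p).
have gd (s : R) : `|s| <= `|r| -> is_derive s 1 g (df (s *: v + p)).
  by move=> /fd; exact: is_derive_line.
have g0 : g 0 = f p by rewrite /g scale0r add0r.
have cg (a b : R) : (forall s, s \in `[a, b] -> `|s| <= `|r|) ->
    {within `[a, b], continuous g}.
  move=> ab; apply: derivable_within_continuous => s /ab sr.
  by have [] := gd _ sr.
case: (lerP 0 r) => r0.
  have ab s : s \in `[0, r] -> `|s| <= `|r|.
    by rewrite in_itv /= => /andP[s0 sr]; rewrite !ger0_norm.
  have [s|c cr E] := @MVT_segment _ g (fun s => df (s *: v + p)) _ _ r0 _ (cg _ _ ab).
    by move=> sr; apply: gd; apply: ab; exact: subset_itv_oo_cc.
  by exists c; [exact: ab|rewrite -g0 -/(g r) E subr0].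
have ab s : s \in `[r, 0] -> `|s| <= `|r|.
  by rewrite in_itv /= => /andP[s0 sr]; rewrite (ltr0_norm r0) ler0_norm // lerN2.
have [s|c cr E] := @MVT_segment _ g (fun s => df (s *: v + p)) _ _ (ltW r0) _ (cg _ _ ab).
  by move=> sr; apply: gd; apply: ab; exact: subset_itv_oo_cc.
exists c; [exact: ab|rewrite -g0 -/(g r) -opprB E]; ring.
Qed.

Lemma xiE p (s : R) : s *: dir_xi + p = (s + p.1, p.2).
Proof.
case: p => a b; apply/pair_equal_spec; split => /=.
  by rewrite ?[s *: 1]mulr1 ?[s *: 0]mulr0 ?add0r.
by rewrite ?[s *: 1]mulr1 ?[s *: 0]mulr0 ?add0r.
Qed.

Lemma etaE p (s : R) : s *: dir_eta + p = (p.1, s + p.2).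
Proof.
case: p => a b; apply/pair_equal_spec; split => /=.
  by rewrite ?[s *: 1]mulr1 ?[s *: 0]mulr0 ?add0r.
by rewrite ?[s *: 1]mulr1 ?[s *: 0]mulr0 ?add0r.
Qed.

(** In a small box two axis-parallel moves join the centre to any point, in both directions, so P is
    locally constant and its trace on D is open and closed in D. No polygonal path has to be
    built. *)
Lemma connected_lines (D P : set (R * R)) (p0 : R * R) :
  open D -> connected D -> D p0 -> P p0 ->
  (forall v, v = dir_xi \/ v = dir_eta -> forall p (r : R),
     (forall s : R, `|s| <= `|r| -> D (s *: v + p)) -> P p -> P (r *: v + p)) ->
  forall p, D p -> P p.
Proof.
move=> Do Dc Dp0 Pp0 step.
have box p : D p -> \forall x \near p, D x /\ (P x <-> P p).
  move=> Dp; have /nbhs_boxP[e e0 eD] := open_nbhs_nbhs (conj Do Dp).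
  (* [step] asks for the whole segment of radius [|r|] about its base point; starting from x it
     reaches twice as far from p as x does. *)
  apply/nbhs_boxP; exists (e / 3); first by rewrite divr_gt0.
  move=> x; set a := x.1 - p.1; set b := x.2 - p.2 => ae be.
  have near0 s t : `|s| <= e / 3 * 2 -> `|t| <= e / 3 * 2 -> D (p.1 + s, p.2 + t).
    by move=> se te; apply: eD; rewrite /= addrC addKr; lra.
  have near1 s t : `|s| <= `|a| -> `|t| <= `|b| -> D (p.1 + s, p.2 + t).
    by move=> sa tb; apply: near0; lra.
  have near2 s t : `|s| <= `|a| -> `|t| <= `|b| -> D (p.1 + a + s, p.2 + t).
    move=> sa tb; rewrite -addrA; apply: near0; last lra.
    by apply: le_trans (ler_normD _ _) _; lra.
  have near3 s t : `|s| <= `|a| -> `|t| <= `|b| -> D (p.1 + s, p.2 + b + t).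
    move=> sa tb; rewrite -addrA; apply: near0; first lra.
    by apply: le_trans (ler_normD _ _) _; lra.
  have x1 : x.1 = p.1 + a by rewrite /a addrC subrK.
  have x2 : x.2 = p.2 + b by rewrite /b addrC subrK.
  have xE : x = (p.1 + a, p.2 + b) by rewrite -x1 -x2; case: (x).
  have n0 c : `|0 : R| <= `|c : R| by rewrite normr0.
  split.
    have := near1 a b (lexx _) (lexx _); by rewrite -xE.
  have xiS := step dir_xi (or_introl erefl).
  have etaS := step dir_eta (or_intror erefl).
  split => [Px|Pp].
    have P1 : P (p.1, p.2 + b).
      have := xiS x (- a); rewrite xiE.
      have -> : (- a + x.1, x.2) = (p.1, p.2 + b) by rewrite x1 x2 addrC addrK.
      apply => // s; rewrite normrN xiE => sa.
      by rewrite x1 x2 addrC; exact: near2.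
    have := etaS (p.1, p.2 + b) (- b); rewrite etaE /=.
    have -> : (p.1, - b + (p.2 + b)) = p by rewrite addrC addrK; case: (p).
    apply => // s; rewrite normrN etaE /= => sb.
    have := near3 0 s (n0 _) sb; by rewrite addr0 [s + _]addrC.
  have P1 : P (p.1 + a, p.2).
    have := xiS p a; rewrite xiE [a + _]addrC; apply => // s sa.
    rewrite xiE; have := near1 s 0 sa (n0 _); by rewrite addr0 addrC.
  have := etaS (p.1 + a, p.2) b; rewrite etaE /= [b + _]addrC -xE; apply => // s sb.
  rewrite etaE /=; have := near1 a s (lexx _) sb; by rewrite [s + _]addrC.
suff <- : D `&` P = D by move=> p [].
apply: Dc; first by exists p0.
- exists (D `&` P)%classic; last by rewrite setIA setIid.
  rewrite openE => p [Dp Pp]; apply: filterS (box p Dp) => x [Dx [_ xp]].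
  by split => //; exact: xp.
- exists (~` (D `&` ~` P))%classic.
    rewrite closedC openE => p [Dp nPp]; apply: filterS (box p Dp) => x [Dx [xp _]].
    by split => // Px; exact/nPp/xp.
  rewrite setCI setCK setIUr setICr set0U //.
Qed.

(** The second difference of f over a square of side h is h^2 times a value of [fxy] and also h^2
    times a value of [fyx], by two mean value theorems in either order. *)
Lemma eq_mixed_derive (f fx fy fxy fyx : R * R -> R) p :
  (\forall x \near p, is_derive x dir_xi f (fx x)) ->
  (\forall x \near p, is_derive x dir_eta f (fy x)) ->
  (\forall x \near p, is_derive x dir_eta fx (fxy x)) ->
  (\forall x \near p, is_derive x dir_xi fy (fyx x)) ->
  fxy @ p --> fxy p -> fyx @ p --> fyx p -> fxy p = fyx p.
Proof.
move=> dx dy dxy dyx cxy cyx; apply/eqP; rewrite -subr_eq0; apply: contraT => d0.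
(* Half the gap: a common value within d of both [fxy p] and [fyx p] would make the gap smaller than
   itself. *)
set d := `|fxy p - fyx p| / 2.
have d_gt0 : 0 < d by rewrite divr_gt0 // normr_gt0.
move: cxy => /cvgrPdist_lt/(_ _ d_gt0) cxy.
move: cyx => /cvgrPdist_lt/(_ _ d_gt0) cyx.
have /nbhs_boxP[e e0 He] : \forall x \near p,
   [/\ is_derive x dir_xi f (fx x), is_derive x dir_eta f (fy x),
      is_derive x dir_eta fx (fxy x), is_derive x dir_xi fy (fyx x) &
      `|fxy p - fxy x| < d /\ `|fyx p - fyx x| < d].
  by near=> x; split; [near: x|near: x|near: x|near: x|split; near: x].
have {}He s t : `|s| <= e / 2 -> `|t| <= e / 2 ->
   let x := (s + p.1, t + p.2) in
   [/\ is_derive x dir_xi f (fx x), is_derive x dir_eta f (fy x),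
      is_derive x dir_eta fx (fxy x), is_derive x dir_xi fy (fyx x) &
      `|fxy p - fxy x| < d /\ `|fyx p - fyx x| < d].
  by move=> se te; apply: He; rewrite /= addrK; lra.
set h := e / 2; have h_gt0 : 0 < h by rewrite divr_gt0.
have h_ge0 := ltW h_gt0; rewrite -/h in He.
have hE : `|h| = h by exact: ger0_norm.
have hh : `|h| <= h by rewrite hE.
have h0 : `|0 : R| <= h by rewrite normr0.
(* The second difference seen as the xi-increment of [f (., h + .) - f]; further down it is the
   eta-increment of [f (h + ., .) - f]. *)
have [s sh Es] : exists2 s : R, `|s| <= `|h| &
    f (h *: dir_xi + (p.1, h + p.2)) - f (h *: dir_xi + p) -
    (f (p.1, h + p.2) - f p) =
    (fx (s + p.1, h + p.2) - fx (s + p.1, p.2)) * h.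
  have [s|s sh Es] := @mvt_line dir_xi p
      (fun x => f (x.1, h + x.2) - f x) (fun x => fx (x.1, h + x.2) - fx x) h.
    rewrite hE xiE => sh; apply: is_deriveB; last first.
      by have [+ _ _ _ _] := He s 0 sh h0; rewrite /= add0r.
    have [+ _ _ _ _] := He s h sh hh; rewrite /= => Hd.
    have E : (fun k : R => k^-1 *: (((fun x => f (x.1, h + x.2)) \o shift (s + p.1, p.2))
        (k *: dir_xi) - f (s + p.1, h + p.2))) =
      (fun k : R => k^-1 *: ((f \o shift (s + p.1, h + p.2)) (k *: dir_xi) - f (s + p.1, h + p.2))).
  by apply/funext => k; rewrite /= !xiE [k%:A]mulr1 [k *: 0]mulr0 add0r.
    by case: Hd => H1 H2; split; rewrite /derivable /derive E.
  by exists s => //; rewrite !xiE /= in Es *.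
have [t th Et] : exists2 t : R, `|t| <= `|h| &
    fx (s + p.1, h + p.2) - fx (s + p.1, p.2) = fxy (s + p.1, t + p.2) * h.
  have [t|t th Et] := @mvt_line dir_eta (s + p.1, p.2) fx fxy h.
    rewrite etaE => th; rewrite hE in sh th.
    by have [] := He s t sh th.
  by exists t => //; rewrite !etaE /= in Et.
have [t' th' Et'] : exists2 t : R, `|t| <= `|h| &
    f (h *: dir_eta + (h + p.1, p.2)) - f (h *: dir_eta + p) -
    (f (h + p.1, p.2) - f p) =
    (fy (h + p.1, t + p.2) - fy (p.1, t + p.2)) * h.
  have [t'|t' th' Et'] := @mvt_line dir_eta p
      (fun x => f (h + x.1, x.2) - f x) (fun x => fy (h + x.1, x.2) - fy x) h.
    rewrite hE etaE => sh'; apply: is_deriveB; last first.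
      by have [_ + _ _ _] := He 0 t' h0 sh'; rewrite /= add0r.
    have [_ + _ _ _] := He h t' hh sh'; rewrite /= => Hd.
    have E : (fun k : R => k^-1 *: (((fun x => f (h + x.1, x.2)) \o shift (p.1, t' + p.2))
        (k *: dir_eta) - f (h + p.1, t' + p.2))) =
      (fun k : R => k^-1 *: ((f \o shift (h + p.1, t' + p.2)) (k *: dir_eta)
         - f (h + p.1, t' + p.2))).
      by apply/funext => k; rewrite /= !etaE [k%:A]mulr1 [k *: 0]mulr0 add0r.
    by case: Hd => H1 H2; split; rewrite /derivable /derive E.
  by exists t' => //; rewrite !etaE /= in Et' *.
have [s' sh' Es'] : exists2 s' : R, `|s'| <= `|h| &
    fy (h + p.1, t' + p.2) - fy (p.1, t' + p.2) = fyx (s' + p.1, t' + p.2) * h.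
  have [s'|s' sh' Es'] := @mvt_line dir_xi (p.1, t' + p.2) fy fyx h.
    rewrite xiE => sh'; rewrite hE in sh' th'.
    by have [] := He s' t' sh' th'.
  by exists s' => //; rewrite !xiE /= in Es'.
have E : fxy (s + p.1, t + p.2) = fyx (s' + p.1, t' + p.2).
  apply: (mulIf (lt0r_neq0 h_gt0)); apply: (mulIf (lt0r_neq0 h_gt0)).
  rewrite -Et -Es -Es' -Et' !xiE !etaE /=; ring.
rewrite hE in sh th sh' th'.
have [_ _ _ _ [A1 _]] := He s t sh th; have [_ _ _ _ [_ A2]] := He s' t' sh' th'.
rewrite /= E in A1; rewrite /= in A2.
have : `|fxy p - fyx p| < d + d.
  set z := fyx _ in A1 A2.
  have -> : fxy p - fyx p = (fxy p - z) - (fyx p - z) by ring.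
  by apply: le_lt_trans (ler_normB _ _) _; exact: ltrD.
by rewrite /d -splitr ltxx.
Unshelve. all: by end_near. Qed.

(** First exit argument: at speed at most M, a time [|r|] does not suffice to cover the remaining
    distance [rho / 2]. All components are followed at once because the speed bound holds only while
    every one of them is inside. *)
Lemma barrier (K : finType) (g dg : K -> R -> R) (c : K -> R) (r rho M : R) :
  0 < rho -> 0 <= M -> M * `|r| <= rho / 2 ->
  (forall s : R, `|s| <= `|r| -> forall k, is_derive s 1 (g k) (dg k s)) ->
  (forall s : R, `|s| <= `|r| -> (forall k, `|g k s - c k| < rho) ->
     forall k, `|dg k s| <= M) ->
  (forall k, `|g k 0 - c k| < rho / 2) -> forall k, `|g k r - c k| < rho.
Proof.
move=> rho0 M0; wlog r0 : g dg r / 0 <= r.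
  move=> W; case: (lerP 0 r) => r0; first exact: W.
  move=> Mr gd gM g0 k.
  have := W (fun k s => g k (- s)) (fun k s => - dg k (- s)) (- r).
  rewrite opprK normrN oppr0; apply => //; first by rewrite oppr_ge0 ltW.
  - move=> s sr k'; rewrite -[- dg _ _]mulrN1.
    have h1 : is_derive (- s) 1 (g k') (dg k' (- s)) by apply: gd; rewrite normrN.
    exact: is_derive1_comp h1 (is_deriveNid _ _).
  - by move=> s sr H k'; rewrite normrN; apply: gM => //; rewrite normrN.
rewrite (ger0_norm r0) => Mr gd gM g0 k; rewrite ltNge; apply/negP => bad.
pose E := [set s : R | 0 <= s <= r /\ exists k, rho <= `|g k s - c k|]%classic.
have Er : E r by split; [rewrite r0 lexx|exists k].
have E0 : has_inf E by split; [exists r|exists 0 => s [/andP[]]].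
have lbE s : E s -> inf E <= s by move=> Es; apply: ge_inf => //; exact: E0.2.
(* The first exit time. *)
set t := inf E in lbE.
have t0 : 0 <= t by apply: lb_le_inf; [exists r|move=> s [/andP[]]].
have tr : t <= r by exact: lbE.
have good s : 0 <= s -> s < t -> forall k, `|g k s - c k| < rho.
  move=> s0 st k'; rewrite ltNge; apply/negP => bs.
  suff /lbE : E s by rewrite leNgt st.
  by split; [rewrite s0 (ltW (lt_le_trans st tr))|exists k'].
have absr s : 0 <= s -> s <= r -> `|s| <= r by move=> s0; rewrite ger0_norm.
have cg s k' : 0 <= s -> s <= r -> {for s, continuous (g k')}.
  move=> s0 sr; have [gs _] := gd s (absr s s0 sr) k'.
  exact/differentiable_continuous/derivable1_diffP.
(* The infimum is attained: otherwise all components, being finitely many and continuous, would stay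
   inside on a neighbourhood of t. *)
have [k' badt] : exists k', rho <= `|g k' t - c k'|.
  apply: contrapT => ne.
  have gt : forall k', `|g k' t - c k'| < rho.
    by move=> k'; rewrite ltNge; apply/negP => ?; apply: ne; exists k'.
  have nt k' : \forall s \near t, `|g k' s - c k'| < rho.
    have : (fun s => `|g k' s - c k'|) @ t --> `|g k' t - c k'|.
      by apply: cvg_norm; apply: cvgB; [exact: cg|exact: cvg_cst].
    by move=> /cvgr_lt; apply; exact: gt.
  have /nbhs_ballP[e /= e0 He] := filter_forall (nbhs_filter t) nt.
  have [s Es st] := inf_adherent e0 E0.
  have [_ [k'']] := Es; rewrite leNgt => /negP; apply; apply: He.
  rewrite /ball /= distrC ger0_norm ?subr_ge0 ?lbE //.
  by rewrite ltrBlDr addrC.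
have [t_gt0|] := ltP 0 t; last first.
  move=> t_le0; have tE : t = 0 by apply/le_anti; rewrite t_le0 t0.
  by have := g0 k'; rewrite -tE; lra.
have [s||s st Es] := @MVT _ (g k') (dg k') 0 t t_gt0.
- rewrite in_itv /= => /andP[s0 st]; apply: gd; apply: absr; first exact: ltW.
  exact: ltW (lt_le_trans st tr).
- apply: derivable_within_continuous => s; rewrite in_itv /= => /andP[s0 st].
  by have [] := gd s (absr _ s0 (le_trans st tr)) k'.
move: st; rewrite in_itv /= => /andP[s0 st].
have dM : `|dg k' s| <= M.
  apply: gM; last by apply: good => //; exact: ltW.
  apply: absr; first exact: ltW.
  exact: ltW (lt_le_trans st tr).
have : `|g k' t - g k' 0| <= rho / 2.
  rewrite Es subr0 normrM (ger0_norm t0); apply: le_trans Mr.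
  exact: ler_pM.
have := g0 k'.
have : `|g k' t - c k'| <= `|g k' t - g k' 0| + `|g k' 0 - c k'|.
  exact: ler_distD.
by lra.
Qed.

End Plane.

(** * Matrix functions on the plane *)

(** The boolean makes the real components of a matrix a family over the finite type
    ['I_k * 'I_l * bool], the form that [barrier] takes. *)
Definition cpart {R : realType} (b : bool) (z : R[i]) : R :=
  if b then complex.Im z else complex.Re z.

(* The trace on the graph of F of the neighbourhoods of (p, F p): along it F
   tends to F p by construction, even before F is known to be continuous. *)
Definition graph_nbhs {R : realType} {k l : nat}
    (F : R * R -> 'M[R[i]]_(k, l)) (p : R * R) : set_system (R * R) :=
  fun P => exists2 rho : R, 0 < rho & \forall x \near p,
    (forall i j b, `|cpart b (F x i j) - cpart b (F p i j)| < rho) -> P x.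

Section MatrixCalculus.
Context {R : realType}.
Implicit Types (v p x : R * R).

Lemma cpartP (z w : R[i]) : (forall b, cpart b z = cpart b w) -> z = w.
Proof.
by case: z w => a b [c d] zw; rewrite (zw false : a = c) (zw true : b = d).
Qed.

Lemma is_pderive_cpart k l v (F : R * R -> 'M[R[i]]_(k, l)) p F' i j b :
  is_pderive v F p F' ->
  is_derive p v (fun x => cpart b (F x i j)) (cpart b (F' i j)).
Proof.
move=> [dF <-]; have [dr di] := dF i j.
by rewrite /cpart mxE; case: b; split.
Qed.

Lemma cvg_cpart k l (F : R * R -> 'M[R[i]]_(k, l)) (Phi : set_system (R * R))
    (L : 'M[R[i]]_(k, l))
    i j b : mxcvg Phi F L -> (fun x => cpart b (F x i j)) @ Phi --> cpart b (L i j).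
Proof. by move=> FL; have [? ?] := FL i j; case: b. Qed.

Lemma mxcvg_cpart k l (F : R * R -> 'M[R[i]]_(k, l)) (Phi : set_system (R * R))
    (L : 'M[R[i]]_(k, l)) :
  (forall i j b, (fun x => cpart b (F x i j)) @ Phi --> cpart b (L i j)) ->
  mxcvg Phi F L.
Proof. by move=> FL i j; split; [exact: (FL i j false)|exact: (FL i j true)]. Qed.

Lemma pderive0_line k l v (F : R * R -> 'M[R[i]]_(k, l)) p (r : R) :
  (forall s : R, `|s| <= `|r| -> is_pderive v F (s *: v + p) 0) ->
  F (r *: v + p) = F p.
Proof.
move=> F0; apply/matrixP => i j; apply: cpartP => b; apply/eqP.
rewrite -subr_eq0.
have [s sr|c _ ->] := @mvt_line R v p (fun x => cpart b (F x i j)) (fun=> 0) r.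
  have := is_pderive_cpart i j b (F0 s sr); rewrite mxE.
  by rewrite (_ : cpart b 0 = 0) //; case: b.
by rewrite mul0r.
Qed.

Lemma eq_mixed_pderive k l (F Fx Fy Fxy Fyx : R * R -> 'M[R[i]]_(k, l)) p :
  (\forall x \near p, is_pderive dir_xi F x (Fx x)) ->
  (\forall x \near p, is_pderive dir_eta F x (Fy x)) ->
  (\forall x \near p, is_pderive dir_eta Fx x (Fxy x)) ->
  (\forall x \near p, is_pderive dir_xi Fy x (Fyx x)) ->
  mxcvg (nbhs p) Fxy (Fxy p) -> mxcvg (nbhs p) Fyx (Fyx p) -> Fxy p = Fyx p.
Proof.
move=> dx dy dxy dyx cxy cyx; apply/matrixP => i j; apply: cpartP => b.
apply: (@eq_mixed_derive R (fun x => cpart b (F x i j))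
  (fun x => cpart b (Fx x i j)) (fun x => cpart b (Fy x i j))
  (fun x => cpart b (Fxy x i j)) (fun x => cpart b (Fyx x i j)));
  [| | | |exact: (@cvg_cpart _ _ _ _ _ i j b cxy)|exact: (@cvg_cpart _ _ _ _ _ i j b cyx)].
- by apply: filterS dx => x; exact: (is_pderive_cpart i j b).
- by apply: filterS dy => x; exact: (is_pderive_cpart i j b).
- by apply: filterS dxy => x; exact: (is_pderive_cpart i j b).
- by apply: filterS dyx => x; exact: (is_pderive_cpart i j b).
Qed.

Lemma graph_nbhs_filter k l (F : R * R -> 'M[R[i]]_(k, l)) p :
  Filter (graph_nbhs F p).
Proof.
split.
- by exists (1 : R); [exact: ltr01|apply: (@filterE _ (nbhs p) (nbhs_filter p))].
- move=> P Q [r r0 rP] [s s0 sQ]; exists (Order.min r s).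
    by rewrite lt_min r0 s0.
  apply: filterS2 rP sQ => x rP sQ small; split; [apply: rP|apply: sQ] => i j b.
    by have := small i j b; rewrite lt_min => /andP[].
  by have := small i j b; rewrite lt_min => /andP[].
- move=> P Q PQ [r r0 rP]; exists r => //.
  by apply: filterS rP => x rP small; apply/PQ/rP.
Qed.

Lemma graph_nbhs_finer k l (F : R * R -> 'M[R[i]]_(k, l)) p (P : set (R * R)) :
  (\forall x \near p, P x) -> graph_nbhs F p P.
Proof. by move=> pP; exists 1 => //; apply: filterS pP. Qed.

Lemma mxcvg_graph k l (F : R * R -> 'M[R[i]]_(k, l)) p :
  mxcvg (graph_nbhs F p) F (F p).
Proof.
apply: mxcvg_cpart => i j b.
have FF := graph_nbhs_filter F p.
apply/cvgrPdist_lt => e e0; exists e => //.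
apply: (@filterE _ (nbhs p) (nbhs_filter p)) => x small.
by rewrite distrC.
Qed.

Lemma mxcvg_finer k l (G : R * R -> 'M[R[i]]_(k, l)) (Phi Psi : set_system (R * R))
  (L : 'M[R[i]]_(k, l)) : Phi `<=` Psi -> mxcvg Phi G L -> mxcvg Psi G L.
Proof.
move=> PP GL i j; have [Gr Gi] := GL i j.
by split=> P /= nP; apply: PP; [exact: Gr|exact: Gi].
Qed.

(* A function leaving every neighbourhood of F p arbitrarily fast would have to
   do so along the graph, where F_xi stays bounded. *)
Lemma mxcvg_joint k l (F F' : R * R -> 'M[R[i]]_(k, l)) p L G :
  (\forall x \near p, is_pderive dir_xi F x (F' x)) ->
  is_pderive dir_eta F p G ->
  mxcvg (graph_nbhs F p) F' L -> mxcvg (nbhs p) F (F p).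
Proof.
move=> dx dy cF'; have FF := graph_nbhs_filter F p.
pose K := ('I_k * 'I_l * bool)%type.
pose cp (x : K) (M : 'M[R[i]]_(k, l)) := cpart x.2 (M x.1.1 x.1.2).
(* One number strictly above the modulus of each component of L. *)
pose M : R := \sum_(x : K) (`|cp x L| + 1).
have M0 : 0 <= M by apply: sumr_ge0 => x _; rewrite addr_ge0.
have bdc (c : K) : graph_nbhs F p (fun x => `|cp c (F' x)| <= M).
  have cM : `|cp c L| < M.
    rewrite /M (bigD1 c) //= -addrA ltrDl ltr_wpDr //.
    by apply: sumr_ge0 => x _; rewrite addr_ge0.
  have : (fun x => `|cp c (F' x)|) @ graph_nbhs F p --> `|cp c L|.
    by apply: cvg_norm; exact: cvg_cpart.
  by move=> /cvgr_le; apply.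
have [rho0 rho0_gt0 bd] := filter_forall FF bdc.
apply: mxcvg_cpart => i0 j0 b0; apply/cvgrPdist_lt => e e0.
pose rho := Order.min rho0 e.
have rho_gt0 : 0 < rho by rewrite lt_min rho0_gt0 e0.
(* The eta-derivative at p alone controls F on the vertical line through p, where the horizontal
   motions start. *)
have [d d0 Hd] : exists2 d : R, 0 < d & forall t : R, `|t| < d ->
    forall c : K, `|cp c (F (t *: dir_eta + p)) - cp c (F p)| < rho / 2.
  have nt (c : K) : \forall t \near (0 : R),
      `|cp c (F (t *: dir_eta + p)) - cp c (F p)| < rho / 2.
    have Hder : is_derive (0 : R) (1 : R) (fun t : R => cp c (F (t *: dir_eta + p))) (cp c G).
      apply: (@is_derive_line _ dir_eta p (fun x => cp c (F x))).
      by rewrite scale0r add0r; exact: is_pderive_cpart.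
    have [Hd _] := Hder.
    have : (fun t : R => cp c (F (t *: dir_eta + p))) @ (0 : R) -->
        cp c (F ((0 : R) *: dir_eta + p)).
      exact/differentiable_continuous/derivable1_diffP.
    rewrite scale0r add0r => /cvgrPdist_lt/(_ (rho / 2)).
    rewrite divr_gt0 // => /(_ isT); apply: filterS => t.
    by rewrite distrC.
  have /nbhs_ballP[d /= d0 Hd] := filter_forall (nbhs_filter (0 : R)) nt.
  by exists d => // t td; apply: Hd; rewrite /ball /= sub0r normrN.
have /nbhs_boxP[d' d'0 Hd'] : \forall x \near p, is_pderive dir_xi F x (F' x) /\
   ((forall i j b, `|cpart b (F x i j) - cpart b (F p i j)| < rho0) ->
    forall c : K, `|cp c (F' x)| <= M).
  by near=> x; split; near: x.
(* The bounds keep the starting point within [rho / 2] of [F p], the horizontal segment where the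
   hypotheses hold, and its length below what is needed to travel [rho / 2]. [M + 1] guards against
   M = 0, the case of an empty matrix. *)
pose h := Order.min (Order.min d d') (rho / 2 / (M + 1)).
have M1 : 0 < M + 1 by rewrite ltr_wpDl.
have h_gt0 : 0 < h by rewrite !lt_min d0 d'0 /= !divr_gt0.
have hd : h <= d by rewrite /h !ge_min lexx.
have hd' : h <= d' by rewrite /h !ge_min lexx orbT.
have hM : M * h <= rho / 2.
  have : h <= rho / 2 / (M + 1) by rewrite /h ge_min lexx orbT.
  rewrite ler_pdivlMr // => hh; apply: le_trans hh.
  by rewrite mulrDr mulr1 mulrC lerDl ltW.
apply/nbhs_boxP; exists h => // x x1 x2.
(* From p to x: vertically to q, then horizontally by r. *)
pose r := x.1 - p.1; pose q := (p.1, x.2).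
have xE : x = r *: dir_xi + q.
  by rewrite xiE /= /r subrK; case: (x).
have qE : q = (x.2 - p.2) *: dir_eta + p by rewrite etaE subrK.
have sq (s : R) : `|s| <= `|r| ->
   let y := s *: dir_xi + q in is_pderive dir_xi F y (F' y) /\
   ((forall i j b, `|cpart b (F y i j) - cpart b (F p i j)| < rho0) ->
    forall c : K, `|cp c (F' y)| <= M).
  move=> sr; apply: Hd'; rewrite xiE /= ?addrK.
    exact: le_lt_trans sr (lt_le_trans x1 hd').
  exact: lt_le_trans x2 hd'.
have bar : forall c : K, `|cp c (F (r *: dir_xi + q)) - cp c (F p)| < rho.
  apply: (@barrier R K (fun c s => cp c (F (s *: dir_xi + q)))
    (fun c s => cp c (F' (s *: dir_xi + q))) (fun c => cp c (F p)) r rho M) => //.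
  - by apply: le_trans hM; rewrite ler_wpM2l // ltW.
  - move=> s sr c; apply: (@is_derive_line _ dir_xi q (fun x => cp c (F x))).
    by apply: is_pderive_cpart; have [] := sq s sr.
  - move=> s sr small c; have [_] := sq s sr; apply => i j b.
    apply: lt_le_trans (small (i, j, b)) _.
    by rewrite /rho ge_min lexx.
  - move=> c; rewrite scale0r add0r qE; apply: Hd.
    exact: lt_le_trans x2 hd.
have := bar (i0, j0, b0); rewrite -xE distrC => H; apply: lt_le_trans H _.
by rewrite /rho ge_min lexx orbT.
Unshelve. all: by end_near. Qed.

End MatrixCalculus.

(** * Algebra of the dressing equations *)

Section MatrixExpansion.
Context {K : fieldType}.

Lemma mulmx_scalel k l n (c : K) (M : 'M[K]_(k, l)) (N : 'M[K]_(l, n)) :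
  (c *: M) *m N = c *: (M *m N).
Proof. by rewrite scalemxAl. Qed.

Lemma mulmx_scaler k l n (c : K) (M : 'M[K]_(k, l)) (N : 'M[K]_(l, n)) :
  M *m (c *: N) = c *: (M *m N).
Proof. by rewrite scalemxAr. Qed.

Definition mxexpand := (@mulmxDl K, @mulmxDr K, @mulmxN K, @mulNmx K,
  @mulmx1 K, @mul1mx K, @mulmx0 K, @mul0mx K, @mulmx_scalel, @mulmx_scaler).

Lemma addmx_entry k l (M N : 'M[K]_(k, l)) i j : (M + N) i j = M i j + N i j.
Proof. by rewrite mxE. Qed.
Lemma oppmx_entry k l (M : 'M[K]_(k, l)) i j : (- M) i j = - M i j.
Proof. by rewrite mxE. Qed.
Lemma scalemx_entry k l c (M : 'M[K]_(k, l)) i j : (c *: M) i j = c * M i j.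
Proof. by rewrite mxE. Qed.
Lemma zeromx_entry k l i j : (0 : 'M[K]_(k, l)) i j = 0.
Proof. by rewrite mxE. Qed.

Definition mxentry := (addmx_entry, oppmx_entry, scalemx_entry, zeromx_entry).

End MatrixExpansion.

(** [mxdistr] expands into a combination of left-associated words; after [mxlinear] an entry of a
    word is an atom for [ring], so a noncommutative identity becomes a linear one. *)
Ltac mxdistr := rewrite ?mulmxA; repeat (progress rewrite ?mxexpand ?mulmxA).
Ltac mxlinear := apply/matrixP => ? ?; rewrite ?mxentry.

Section DressingAlgebra.
Context {K : fieldType} (ii : K) (iiN1 : ii * ii = -1) {m n : nat}.
Variables (a : K) (A As B Bs S : 'M[K]_n) (Pi : 'M[K]_(n, m))
  (Pis : 'M[K]_(m, n)) (q qs J : 'M[K]_m).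
Hypotheses (AB : (A - 1%:M) *m B = 1%:M) (BA : B *m (A - 1%:M) = 1%:M).
Hypotheses (ABs : (As - 1%:M) *m Bs = 1%:M) (BAs : Bs *m (As - 1%:M) = 1%:M).
Hypothesis Jqs : J *m qs = - (q *m J).

(** The primed letters are the velocities prescribed by the xi-equations. The adjoints are
    independent letters, tied to the rest only by the resolvent relations and [Jqs]. *)
Let A' := - a *: A - (2 * a) *: 1%:M - (2 * a) *: B.
Let As' := - a *: As - (2 * a) *: 1%:M - (2 * a) *: Bs.
Let Pi' := B *m Pi *m q.
Let Pis' := qs *m Pis *m Bs.
Let S' := a *: (S - 2 *: (B *m S *m Bs)) - ii *: (B *m Pi *m q *m J *m Pis *m Bs).

(** The resolvent relations as rewrite rules that lower the degree; the variants ending in [r] act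
    inside left-associated words. *)
Let mulAB : A *m B = 1%:M + B.
Proof. by move: AB; rewrite mulmxBl mul1mx => /eqP; rewrite subr_eq => /eqP. Qed.
Let mulBA : B *m A = 1%:M + B.
Proof. by move: BA; rewrite mulmxBr mulmx1 => /eqP; rewrite subr_eq => /eqP. Qed.
Let mulBAs : Bs *m As = 1%:M + Bs.
Proof. by move: BAs; rewrite mulmxBr mulmx1 => /eqP; rewrite subr_eq => /eqP. Qed.
Let mulABs : As *m Bs = 1%:M + Bs.
Proof. by move: ABs; rewrite mulmxBl mul1mx => /eqP; rewrite subr_eq => /eqP. Qed.
Let mulABr k (M : 'M[K]_(k, n)) : M *m A *m B = M + M *m B.
Proof. by rewrite -mulmxA mulAB mulmxDr mulmx1. Qed.
Let mulBAr k (M : 'M[K]_(k, n)) : M *m B *m A = M + M *m B.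
Proof. by rewrite -mulmxA mulBA mulmxDr mulmx1. Qed.
Let mulABsr k (M : 'M[K]_(k, n)) : M *m As *m Bs = M + M *m Bs.
Proof. by rewrite -mulmxA mulABs mulmxDr mulmx1. Qed.
Let mulBAsr k (M : 'M[K]_(k, n)) : M *m Bs *m As = M + M *m Bs.
Proof. by rewrite -mulmxA mulBAs mulmxDr mulmx1. Qed.
Let mulJqs k (M : 'M[K]_(k, m)) : M *m J *m qs = - (M *m q *m J).
Proof. by rewrite -mulmxA Jqs mulmxN mulmxA. Qed.
Let rels := (mulAB, mulBA, mulABs, mulBAs, mulABr, mulBAr, mulABsr, mulBAsr,
  Jqs, mulJqs).

Lemma sylvester_derive :
  (A' *m S + A *m S') - (S' *m As + S *m As')
  - ii *: ((Pi' *m J) *m Pis + (Pi *m J) *m Pis') = 0.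
Proof.
rewrite /A' /As' /S' /Pi' /Pis'.
mxdistr; rewrite ?rels; mxdistr; rewrite ?rels; mxdistr.
by mxlinear; ring.
Qed.

(* (A + 1)^3 (A - 1)^-1 with B = (A - 1)^-1.  Since A Z = Z A^* for the defect
   Z = S - S^*, its flow is Z' = a (1 - 2 B^2) Z; on commuting scalars
   dA = - a A (A + 1) (A - 1)^-1, and partial fractions give the integrating
   factor alpha (A + 1)^3 (A - 1)^-1. *)
Definition hermite_factor : 'M[K]_n := A *m A + 4 *: A + 7 *: 1%:M + 8 *: B.

(** Exhibits the factor as a product of invertible matrices; the invertibility of A + 1 enters
    here. *)
Lemma hermite_factorE :
  hermite_factor = (A + 1%:M) *m (A + 1%:M) *m (A + 1%:M) *m B.
Proof.
rewrite /hermite_factor; mxdistr; rewrite ?rels; mxdistr; rewrite ?rels; mxdistr.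
by rewrite ?rels; mxlinear; ring.
Qed.

(** The inhomogeneous term of the S-equation is selfadjoint, hence cancels in S - S^*. *)
Lemma hermitian_defect (Ss : 'M[K]_n) :
  S' - (a *: (Ss - 2 *: (B *m Ss *m Bs))
        + ii *: (B *m Pi *m (- (q *m J)) *m Pis *m Bs))
  = a *: ((S - Ss) - 2 *: (B *m (S - Ss) *m Bs)).
Proof. by rewrite /S'; mxdistr; mxlinear; ring. Qed.

Lemma hermite_factor_derive (Z : 'M[K]_n) : A *m Z = Z *m As ->
  a *: (hermite_factor *m Z) +
  ((A' *m A + A *m A' + 4 *: A' + 8 *: (- (B *m A' *m B))) *m Z +
   hermite_factor *m (a *: (Z - 2 *: (B *m Z *m Bs)))) = 0.
Proof.
move=> AZ.
(* The intertwining passes to the resolvents, so every word becomes a function of A times Z. *)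
have ZBs : Z *m Bs = B *m Z.
  have := congr1 (fun M => B *m M *m Bs) AZ.
  mxdistr; rewrite ?rels; mxdistr; rewrite ?rels; mxdistr => /matrixP E.
  by apply/matrixP => i j; have := E i j; rewrite ?mxentry => /addIr.
have ZBsr k (M : 'M[K]_(k, n)) : M *m Z *m Bs = M *m B *m Z.
  by rewrite -mulmxA ZBs mulmxA.
rewrite /hermite_factor /A'.
mxdistr; rewrite ?rels ?ZBsr; mxdistr; rewrite ?rels ?ZBsr; mxdistr.
by rewrite ?rels; mxdistr; rewrite ?rels; mxdistr; mxlinear; ring.
Qed.

(** * Identities involving the inverses of S and A *)

Section Inverses.
Variables (T G : 'M[K]_n).
Hypotheses (TS : T *m S = 1%:M) (ST : S *m T = 1%:M).
Hypotheses (GA : G *m A = 1%:M) (AG : A *m G = 1%:M).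
Hypothesis SylvesterS : A *m S - S *m As = ii *: (Pi *m J *m Pis).

(* With w(l) = 1 - i y (A - l)^-1 Pi, W = w(1), Wi = w(1)^-1 and W' is the
   derivative w'(1); the Darboux matrix is w(0), and qh is the coefficient of
   the dressed solution. *)
Let y := J *m Pis *m T.
Let jn := J *m Pis *m Bs *m T.
Let W := 1%:M - ii *: (y *m B *m Pi).
Let Wi := 1%:M + ii *: (jn *m Pi).
Let W' := - (ii *: (y *m B *m B *m Pi)).
Let qh := W *m q *m Wi + (2 * a) *: (W' *m Wi).

Let mulBG : B *m G = B - G.
Proof.
have : B *m (A - (A - 1%:M)) *m G = B *m G by rewrite subKr mulmx1.
by rewrite mulmxBr BA mulmxBl -mulmxA AG mulmx1 mul1mx => <-.
Qed.
Let mulGB : G *m B = B - G.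
Proof.
have : G *m (A - (A - 1%:M)) *m B = G *m B by rewrite subKr mulmx1.
by rewrite mulmxBr GA mulmxBl -mulmxA AB mulmx1 mul1mx => <-.
Qed.
Let mulBGr k (M : 'M[K]_(k, n)) : M *m B *m G = M *m B - M *m G.
Proof. by rewrite -mulmxA mulBG mulmxBr. Qed.
Let mulGBr k (M : 'M[K]_(k, n)) : M *m G *m B = M *m B - M *m G.
Proof. by rewrite -mulmxA mulGB mulmxBr. Qed.
Let mulAGr k (M : 'M[K]_(k, n)) : M *m A *m G = M.
Proof. by rewrite -mulmxA AG mulmx1. Qed.
Let mulTSr k (M : 'M[K]_(k, n)) : M *m T *m S = M.
Proof. by rewrite -mulmxA TS mulmx1. Qed.
Let mulSTr k (M : 'M[K]_(k, n)) : M *m S *m T = M.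
Proof. by rewrite -mulmxA ST mulmx1. Qed.
(** Since [A S - S As = (A - 1) S - S (As - 1)], sandwiching the Sylvester identity between [B] and
    [Bs] moves the resolvent across S. *)
Let SBs : S *m Bs = B *m S + ii *: (B *m Pi *m J *m Pis *m Bs).
Proof.
have := congr1 (fun M => B *m M *m Bs) SylvesterS.
mxdistr; rewrite ?rels => <-.
mxdistr; rewrite ?rels; mxdistr.
by mxlinear; ring.
Qed.

Let SBsT : S *m Bs *m T = B + ii *: (B *m Pi *m jn).
Proof. by rewrite SBs /jn; mxdistr; rewrite mulSTr. Qed.

(** That is, [y *m B = W *m jn]. It yields the inverse of [W] and later removes [Bs] in favour of
    [B]. *)
Let jnE : jn = y *m B + ii *: (y *m B *m Pi *m jn).
Proof.
transitivity (y *m (S *m Bs *m T)); first by rewrite /y ?mulmxA mulTSr.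
by rewrite SBsT; mxdistr.
Qed.

Let WWi : W *m Wi = 1%:M.
Proof.
rewrite /W /Wi; mxdistr; rewrite {1}jnE; mxdistr.
by mxlinear; ring.
Qed.

Let WiW : Wi *m W = 1%:M. Proof. exact: mulmx1C. Qed.

Let qhW : qh *m W = W *m q + (2 * a) *: W'.
Proof. by rewrite /qh mulmxDl -scalemxAl -!mulmxA WiW !mulmx1. Qed.

Let jnWi : Wi *m (y *m B) = jn.
Proof.
have -> : y *m B = W *m jn by rewrite /W mulmxBl mul1mx -scalemxAl {1}jnE addrK.
by rewrite mulmxA WiW mul1mx.
Qed.

Let y' := J *m Pis' *m T + J *m Pis *m (- (T *m S' *m T)).

(** The equation for [y] closes: all adjoint data are absorbed in [qh]. The derivatives of the
    Darboux matrix and of [y *m Pi] follow from it by inserting the equations of A and Pi. *)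
Lemma dressed_row_derive :
  y' = - (qh *m y *m B) - a *: y + (2 * a) *: (y *m B *m B).
Proof.
have E1 : J *m Pis' *m T = - (q *m jn).
  by rewrite /Pis' /jn !mulmxA Jqs !mulNmx.
have E2 : J *m Pis *m (T *m S' *m T) = a *: y
    - (2 * a) *: (y *m B *m (S *m Bs *m T)) - ii *: (y *m B *m Pi *m q *m jn).
  have -> : J *m Pis *m (T *m S' *m T) = y *m S' *m T by rewrite /y !mulmxA.
  have -> : a *: y = a *: (y *m (S *m T)) by rewrite ST mulmx1.
  rewrite /jn /S' !mulmxA.
  rewrite mulmxBr mulmxBl !mulmx_scaler mulmxBr !mulmx_scaler !mulmx_scalel.
  by rewrite mulmxBl !mulmx_scalel scalerBr scalerA [a * 2]mulrC !mulmxA.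
have E3 : qh *m y *m B = W *m q *m jn + (2 * a) *: (W' *m jn).
  rewrite scalemxAl -mulmxDl -qhW -jnWi !mulmxA.
  by rewrite -[qh *m W *m Wi]mulmxA WWi mulmx1.
rewrite /y' mulmxN E1 E2 E3 SBsT /W /W'.
rewrite !mulmxBl !mul1mx !mulNmx !mulmx_scalel !mulmxDr !mulmx_scaler !mulmxA.
mxlinear. ring.
Qed.

(** [qhW] with [W] expanded. In this fixed-point form [qh] can be treated as a letter. *)
Let qhE : qh = q - ii *: (y *m B *m Pi *m q)
  - (2 * a * ii) *: (y *m B *m B *m Pi) + ii *: (qh *m y *m B *m Pi).
Proof.
have -> : q - ii *: (y *m B *m Pi *m q) - (2 * a * ii) *: (y *m B *m B *m Pi)
    = qh *m W.
  by rewrite qhW /W /W' mulmxBl mul1mx mulmx_scalel scalerN scalerA.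
by rewrite /W mulmxBr mulmx1 mulmx_scaler !mulmxA subrK.
Qed.

Lemma darboux_derive :
  - (ii *: (y' *m G *m Pi + y *m (- (G *m A' *m G)) *m Pi + y *m G *m Pi'))
  = qh *m (1%:M - ii *: (y *m G *m Pi)) - (1%:M - ii *: (y *m G *m Pi)) *m q.
Proof.
move: dressed_row_derive qhE.
(* From here on [y'] and [qh] are opaque: only the two relations just introduced are used. *)
generalize y' qh y => z' r z z'E rE.
(* The squares of [G] cancel because 0 is a rest point of the scalar flow of A. *)
have GA'G : G *m A' *m G = a *: (G - 2 *: B).
  rewrite /A' !mulmxBr !mulmxBl !mulmx_scaler !mulmx_scalel GA mul1mx mulmx1.
  by rewrite mulGB mulmxBl mulBG; mxlinear; ring.
have rq : r - q = ii *: (r *m z *m B *m Pi) - ii *: (z *m B *m Pi *m q)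
    - (2 * a * ii) *: (z *m B *m B *m Pi).
  by apply/eqP; rewrite subr_eq; apply/eqP; rewrite {1}rE; mxlinear; ring.
have -> : r *m (1%:M - ii *: (z *m G *m Pi)) - (1%:M - ii *: (z *m G *m Pi)) *m q
   = (r - q) - ii *: (r *m z *m G *m Pi) + ii *: (z *m G *m Pi *m q).
  rewrite mulmxBr mulmxBl mulmx1 mul1mx mulmx_scaler mulmx_scalel !mulmxA.
  by mxlinear; ring.
have -> : z *m G *m Pi' = z *m B *m Pi *m q - z *m G *m Pi *m q.
  by rewrite /Pi' !mulmxA mulGBr !mulmxBl.
have -> : z' *m G *m Pi = - (r *m z *m B *m Pi) + r *m z *m G *m Pi
    + a *: (z *m G *m Pi) + (2 * a) *: (z *m B *m B *m Pi) - (2 * a) *: (z *m B *m Pi).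
  rewrite z'E !mulmxDl !mulNmx !mulmx_scalel !mulBGr !mulmxBl.
  by mxlinear; ring.
rewrite rq GA'G mulmxN mulNmx mulmx_scaler mulmxBr mulmx_scaler mulmx_scalel.
by rewrite mulmxBl mulmx_scalel; mxlinear; ring.
Qed.

(** The weight [al] is chosen to cancel the term [- a *: y] of [dressed_row_derive]; the rest is
    proportional to [qh - q] by [qhE]. *)
Lemma dressed_moment_derive (al al' : K) : al' = al * a ->
  al' *: (y *m Pi) + al *: (y' *m Pi + y *m Pi') = (ii * al) *: (qh - q).
Proof.
move: dressed_row_derive qhE.
generalize y' qh y => z' r z z'E rE.
move=> ->.
have rq : r - q = ii *: (r *m z *m B *m Pi) - ii *: (z *m B *m Pi *m q)
    - (2 * a * ii) *: (z *m B *m B *m Pi).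
  by apply/eqP; rewrite subr_eq; apply/eqP; rewrite {1}rE; mxlinear; ring.
rewrite rq z'E /Pi' !mulmxDl !mulNmx !mulmx_scalel !mulmxA.
by mxlinear; ring: iiN1.
Qed.

(** The Sylvester identity replaces [Pi J Pis] by a difference in which S and A cancel the adjacent
    inverses, so the quadratic term of the product collapses to the linear ones. *)
Lemma darboux_isometry (Gs : 'M[K]_n) : Gs *m As = 1%:M -> J *m J = 1%:M ->
  (1%:M + ii *: (Pis *m Gs *m T *m Pi *m J)) *m J
    *m (1%:M - ii *: (J *m Pis *m T *m G *m Pi)) = J.
Proof.
move=> GAs JJ.
have PJP : Pis *m Gs *m T *m Pi *m J *m Pis *m T *m G *m Pi =
    - ii *: (Pis *m Gs *m T *m Pi - Pis *m T *m G *m Pi).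
  have -> : Pis *m Gs *m T *m Pi *m J *m Pis *m T *m G *m Pi =
    Pis *m Gs *m T *m (Pi *m J *m Pis) *m T *m G *m Pi by rewrite !mulmxA.
  have -> : Pi *m J *m Pis = - ii *: (A *m S - S *m As).
    by rewrite SylvesterS scalerA mulNr iiN1 opprK scale1r.
  rewrite mulmx_scaler !mulmx_scalel mulmxBr !mulmxBl !mulmxA.
  rewrite !mulTSr mulSTr mulAGr; congr (_ *: (_ - _)).
  by rewrite -[Pis *m Gs *m As]mulmxA GAs mulmx1.
have -> : (1%:M + ii *: (Pis *m Gs *m T *m Pi *m J)) *m J =
    J + ii *: (Pis *m Gs *m T *m Pi).
  by rewrite mulmxDl mul1mx mulmx_scalel -mulmxA JJ mulmx1.
rewrite mulmxBr mulmx1 mulmxDl !mulmx_scaler !mulmx_scalel !mulmxA PJP JJ mul1mx.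
by mxlinear; ring: iiN1.
Qed.

End Inverses.
End DressingAlgebra.

(** * The change of signs that exchanges the two directions *)

Section Reflection.
Context {K : fieldType} (ii b : K) {m n : nat}.
Variables (A B Bs S : 'M[K]_n) (Pi : 'M[K]_(n, m)) (Pis : 'M[K]_(m, n)) (r J : 'M[K]_m).

(** [B] is meant to be the inverse of A + 1, so that [- B] is the inverse of - A - 1. *)
Lemma reflect_flow_A : - (- b *: A + (2 * b) *: 1%:M - (2 * b) *: B)
  = - b *: (- A) - (2 * b) *: 1%:M - (2 * b) *: (- B).
Proof. by mxlinear; ring. Qed.

Lemma reflect_flow_S : - (b *: (S - 2 *: (B *m S *m Bs))
    - ii *: (B *m Pi *m (- r) *m J *m Pis *m Bs))
  = b *: (- S - 2 *: (- B *m - S *m - Bs))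
    - ii *: (- B *m Pi *m r *m J *m Pis *m - Bs).
Proof. by mxdistr; mxlinear; ring. Qed.

End Reflection.

(** * Dressing along one direction *)

Section Adjoint.
Context {R : realType}.

Lemma ctrmxM k l n (M : 'M[R[i]]_(k, l)) (N : 'M[R[i]]_(l, n)) :
  (M *m N)^t* = N^t* *m M^t*.
Proof. by rewrite trmx_mul map_mxM. Qed.

Lemma ctrmxD k l (M N : 'M[R[i]]_(k, l)) : (M + N)^t* = M^t* + N^t*.
Proof. by rewrite !linearD /= map_mxD. Qed.

Lemma ctrmxN k l (M : 'M[R[i]]_(k, l)) : (- M)^t* = - M^t*.
Proof. by rewrite !linearN /= map_mxN. Qed.

Lemma ctrmxZ k l (c : R[i]) (M : 'M[R[i]]_(k, l)) :
  (c *: M)^t* = Num.conj c *: M^t*.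
Proof. by apply/matrixP => i j; rewrite !mxE rmorphM. Qed.

Lemma ctrmx1 k : (1%:M : 'M[R[i]]_k)^t* = 1%:M.
Proof. by rewrite trmx1 map_mx1. Qed.

Lemma ctrmx_inv k (M : 'M[R[i]]_k) : (invmx M)^t* = invmx (M^t*).
Proof. by rewrite trmx_inv map_invmx. Qed.

Lemma ctrmx_unit k (M : 'M[R[i]]_k) : (M^t* \in unitmx) = (M \in unitmx).
Proof. by rewrite map_unitmx unitmx_tr. Qed.

Lemma conj_realC (x : R) : Num.conj (x%:C : R[i]) = x%:C.
Proof. exact: conjc_real. Qed.

Lemma conj_i : Num.conj ('i : R[i]) = - 'i.
Proof. exact: conjCi. Qed.

Lemma adj_flow_S m n (a : R) (B Bs S : 'M[R[i]]_n) (Pi : 'M[R[i]]_(n, m))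
    (Pis : 'M[R[i]]_(m, n)) (q J : 'M[R[i]]_m) :
  (a%:C *: (S - 2 *: (B *m S *m Bs)) - 'i *: (B *m Pi *m q *m J *m Pis *m Bs))^t*
  = a%:C *: (S^t* - 2 *: (Bs^t* *m S^t* *m B^t*))
    + 'i *: (Bs^t* *m Pis^t* *m (J^t* *m q^t*) *m Pi^t* *m B^t*).
Proof.
rewrite ctrmxD ctrmxN; congr (_ + _).
  rewrite ctrmxZ (conj_realC a) ctrmxD ctrmxN ctrmxZ rmorph_nat ctrmxM ctrmxM !mulmxA //.
by rewrite ctrmxZ conj_i scaleNr opprK 5!ctrmxM !mulmxA.
Qed.

Lemma ctrmx_darboux m n (J : 'M[R[i]]_m) (P : 'M[R[i]]_(n, m)) (T G : 'M[R[i]]_n) :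
  (1%:M - 'i *: (J *m P^t* *m T *m G *m P))^t*
  = 1%:M + 'i *: (P^t* *m G^t* *m T^t* *m P *m J^t*).
Proof.
rewrite ctrmxD ctrmxN ctrmx1 ctrmxZ conj_i scaleNr opprK 4!ctrmxM trmxCK.
by rewrite !mulmxA.
Qed.

Lemma sylvester_opp n (A S : 'M[R[i]]_n) :
  - A *m - S - - S *m (- A)^t* = A *m S - S *m A^t*.
Proof. by rewrite ctrmxN !mulmxN !mulNmx !opprK. Qed.

Lemma ii_N1 : 'i * 'i = -1 :> R[i].
Proof. by rewrite -expr2 sqrCi. Qed.

End Adjoint.

Definition ctrmxE := (@ctrmxM, @ctrmxD, @ctrmxN, @ctrmxZ, @ctrmx1, @ctrmx_inv).

Section Flow.
Context {R : realType}.
Implicit Types (v p x : R * R).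

(** Formulated for any direction and at one point, q and a being values at that point, so that the
    same lemmas serve xi and, after the change of signs, eta. *)
Record dressing_flow {m n : nat} (v : R * R) (J : 'M[R[i]]_m)
    (q : 'M[R[i]]_m) (a : R)
    (A : R * R -> 'M[R[i]]_n) (Pi : R * R -> 'M[R[i]]_(n, m))
    (S : R * R -> 'M[R[i]]_n) (p : R * R) : Prop := DressingFlow {
  flow_unit : A p - 1%:M \in unitmx;
  flow_skew : q *m J = - (J *m q^t*);
  flow_A : is_pderive v A p (- a%:C *: A p - (2 * a%:C) *: 1%:M
             - (2 * a%:C) *: invmx (A p - 1%:M));
  flow_Pi : is_pderive v Pi p (invmx (A p - 1%:M) *m Pi p *m q);
  flow_S : is_pderive v S p
    (a%:C *: (S p - 2 *: (invmx (A p - 1%:M) *m S p *m invmx ((A p)^t* - 1%:M)))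
     - 'i *: (invmx (A p - 1%:M) *m Pi p *m q *m J *m (Pi p)^t*
              *m invmx ((A p)^t* - 1%:M))) }.

(** The coefficient [qh] of the algebraic part with true adjoints. It is linear in the pair (q, a),
    whence the complex a. *)
Definition dressed {m n : nat} (J : 'M[R[i]]_m)
    (A : R * R -> 'M[R[i]]_n) (Pi : R * R -> 'M[R[i]]_(n, m))
    (S : R * R -> 'M[R[i]]_n) (q : 'M[R[i]]_m) (a : R[i]) (p : R * R)
    : 'M[R[i]]_m :=
  let B := invmx (A p - 1%:M) in
  let y := J *m (Pi p)^t* *m invmx (S p) in
  let Wi := 1%:M + 'i *: (J *m (Pi p)^t* *m invmx ((A p)^t* - 1%:M)
                          *m invmx (S p) *m Pi p) in
  (1%:M - 'i *: (y *m B *m Pi p)) *m q *m Wi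
  + (2 * a) *: (- ('i *: (y *m B *m B *m Pi p)) *m Wi).

(** Scalar factors are carried as scalar matrices, so that the matrix product rule covers
    multiplication by [alpha]. *)
Lemma is_pderive_real k v (g : R * R -> R) p g' : is_derive p v g g' ->
  is_pderive v (fun x => ((g x)%:C)%:M : 'M[R[i]]_k) p (g'%:C)%:M.
Proof.
move=> [dg gE]; apply/is_pderiveP.
have cg : (fun h : R => h^-1 *: ((g \o shift p) (h *: v) - g p)) @ 0^' --> g'.
  by rewrite -gE.
apply: (near_eq_mxcvg _ (mxcvg_scalar (ccvg_real cg))); apply: nearW => h.
apply/matrixP => i j; rewrite !mxE; case: (i == j); last by rewrite subr0 mulr0.
by rewrite !mulr1n rmorphM rmorphB.
Qed.

Section OneDirection.
Context {m n : nat} (v : R * R) (J q : 'M[R[i]]_m) (a : R).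
Context (A S : R * R -> 'M[R[i]]_n) (Pi : R * R -> 'M[R[i]]_(n, m)) (p : R * R).
Hypothesis flow : dressing_flow v J q a A Pi S p.

Let AB : (A p - 1%:M) *m invmx (A p - 1%:M) = 1%:M.
Proof. by rewrite mulmxV //; exact: flow_unit flow. Qed.
Let BA : invmx (A p - 1%:M) *m (A p - 1%:M) = 1%:M.
Proof. by rewrite mulVmx //; exact: flow_unit flow. Qed.
Let As_unit : (A p)^t* - 1%:M \in unitmx.
Proof. by have := flow_unit flow; rewrite -ctrmx_unit ctrmxD ctrmxN ctrmx1. Qed.
Let ABs := mulmxV As_unit.
Let BAs := mulVmx As_unit.
Let Jqs : J *m q^t* = - (q *m J).
Proof. by rewrite (flow_skew flow) opprK. Qed.

Let flow_As : is_pderive v (fun x => (A x)^t*) p (- a%:C *: (A p)^t*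
  - (2 * a%:C) *: 1%:M - (2 * a%:C) *: invmx ((A p)^t* - 1%:M)).
Proof.
have := is_pderive_adj (flow_A flow); rewrite !ctrmxE.
by rewrite !rmorphN !rmorphM /= !(conj_realC a) rmorph_nat.
Qed.

Let flow_Pis : is_pderive v (fun x => (Pi x)^t*) p
  (q^t* *m (Pi p)^t* *m invmx ((A p)^t* - 1%:M)).
Proof. by have := is_pderive_adj (flow_Pi flow); rewrite !ctrmxE mulmxA. Qed.

Lemma sylvester_flow : is_pderive v (fun x => A x *m S x - S x *m (A x)^t*
  - 'i *: (Pi x *m J *m (Pi x)^t*)) p 0.
Proof.
have H := sylvester_derive 'i a%:C (S p) (Pi p) ((Pi p)^t*) AB BAs Jqs.
have := is_pderiveB (is_pderiveB (is_pderiveM (flow_A flow) (flow_S flow))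
  (is_pderiveM (flow_S flow) flow_As))
  (is_pderiveZ 'i (is_pderiveM (is_pderiveM (flow_Pi flow) (is_pderive_cst v p J))
     flow_Pis)).
by rewrite mulmx0 addr0 H.
Qed.

Lemma hermite_flow (alpha : R * R -> R) : J = J^t* ->
  is_derive p v alpha (alpha p * a) ->
  A p *m (S p - (S p)^t*) = (S p - (S p)^t*) *m (A p)^t* ->
  is_pderive v (fun x => ((alpha x)%:C)%:M *m (hermite_factor (A x) (invmx (A x - 1%:M))
    *m (S x - (S x)^t*))) p 0.
Proof.
move=> J_herm dalpha AZ; set B := invmx (A p - 1%:M).
have dZ : is_pderive v (fun x => S x - (S x)^t*) p (a%:C *: ((S p - (S p)^t*)
    - 2 *: (B *m (S p - (S p)^t*) *m invmx ((A p)^t* - 1%:M)))).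
  have dS := flow_S flow; apply: is_pderive_eq (is_pderiveB dS (is_pderive_adj dS)) _.
  rewrite -/B; set Bs := invmx ((A p)^t* - 1%:M).
  have BE : B^t* = Bs by rewrite /B ctrmx_inv ctrmxD ctrmxN ctrmx1.
  have BsE : Bs^t* = B by rewrite -BE trmxCK.
  rewrite adj_flow_S BE BsE trmxCK -J_herm Jqs.
  exact: hermitian_defect.
have dA := flow_A flow.
have dAm := is_pderive_eq (is_pderiveB dA (is_pderive_cst v p 1%:M)) (subr0 _).
have dB := is_pderive_inv (flow_unit flow) dAm.
have dA2 := is_pderive_eq (is_pderiveD (is_pderiveD (is_pderiveM dA dA)
   (is_pderiveZ 4 dA)) (is_pderive_cst v p (7 *: 1%:M))) (addr0 _).
have dg := is_pderiveD dA2 (is_pderiveZ 8 dB).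
have dW := is_pderiveM (@is_pderive_real n v alpha p _ dalpha) (is_pderiveM dg dZ).
have H := hermite_factor_derive a%:C AB BA ABs AZ.
apply: is_pderive_eq dW _.
have alE : (alpha p * a)%:C = (alpha p)%:C * a%:C by rewrite rmorphM.
rewrite mul_scalar_mx [X in _ + X]mul_scalar_mx alE -scalerA -scalerDr.
by rewrite H scaler0.
Qed.

Lemma darboux_flow : A p \in unitmx -> S p \in unitmx ->
  A p *m S p - S p *m (A p)^t* = 'i *: (Pi p *m J *m (Pi p)^t*) ->
  is_pderive v (darboux J A Pi S) p
    (dressed J A Pi S q a%:C p *m darboux J A Pi S p - darboux J A Pi S p *m q).
Proof.
move=> Au Su Syl.
have H := darboux_derive a%:C AB BA ABs Jqs (mulVmx Su) (mulmxV Su) (mulVmx Au)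
  (mulmxV Au) Syl.
have dy := is_pderiveM (is_pderiveM (is_pderive_cst v p J) flow_Pis)
  (is_pderive_inv Su (flow_S flow)).
apply: is_pderive_eq (is_pderiveB (is_pderive_cst v p 1%:M) (is_pderiveZ 'i
  (is_pderiveM (is_pderiveM dy (is_pderive_inv Au (flow_A flow))) (flow_Pi flow)))) _.
by rewrite /dressed /darboux -H mul0mx !add0r -mulmxDl.
Qed.

Lemma moment_flow (alpha : R * R -> R) : is_derive p v alpha (alpha p * a) ->
  A p \in unitmx -> S p \in unitmx ->
  A p *m S p - S p *m (A p)^t* = 'i *: (Pi p *m J *m (Pi p)^t*) ->
  is_pderive v (fun x => ((alpha x)%:C)%:M *m (J *m (Pi x)^t* *m invmx (S x) *m Pi x)) p
    (('i * (alpha p)%:C) *: (dressed J A Pi S q a%:C p - q)).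
Proof.
move=> dalpha Au Su Syl.
have alE : (alpha p * a)%:C = (alpha p)%:C * a%:C by rewrite rmorphM.
have H := dressed_moment_derive ii_N1 BA ABs Jqs (mulVmx Su) (mulmxV Su)
  Syl alE.
have dy := is_pderiveM (is_pderiveM (is_pderive_cst v p J) flow_Pis)
  (is_pderive_inv Su (flow_S flow)).
apply: is_pderive_eq (is_pderiveM (@is_pderive_real m v alpha p _ dalpha)
  (is_pderiveM dy (flow_Pi flow))) _.
by rewrite mul0mx add0r !mul_scalar_mx H.
Qed.

End OneDirection.
End Flow.

(** * Functions with a continuous partial derivative *)

Lemma unitmx_opp {R : realType} k (M : 'M[R[i]]_k) : (- M \in unitmx) = (M \in unitmx).
Proof. by rewrite -scaleN1r unitmxZ // unitrN1. Qed.

(** Holds for singular M as well, where [invmx M] is M; this makes [darbouxN] an equality of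
    functions on the whole plane. *)
Lemma invmx_opp {R : realType} k (M : 'M[R[i]]_k) : invmx (- M) = - invmx M.
Proof.
have [Mu|Mu] := boolP (M \in unitmx); last first.
  by rewrite /invmx unitmx_opp (negbTE Mu).
by rewrite -scaleN1r invmxZ ?scaleN1r ?unitmx_opp // invrN1 scaleN1r.
Qed.

Definition mxcont_on {R : realType} (G : set (R * R)) {k l : nat}
    (F : R * R -> 'M[R[i]]_(k, l)) : Prop :=
  forall p, G p -> mxcvg (nbhs p) F (F p).

(** Only one direction is involved: f being merely C1, alpha_xi = f'(xi) has an eta-derivative but
    possibly no xi-derivative, and the coefficients built from it inherit this asymmetry. *)
Definition regular_on {R : realType} (v : R * R) (G : set (R * R)) {k l : nat}
    (F : R * R -> 'M[R[i]]_(k, l)) : Prop :=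
  [/\ forall p, G p -> pderivable v F p, mxcont_on G F & mxcont_on G (pderive v F)].

Section Regular.
Context {R : realType} (v : R * R) (G : set (R * R)) (G_open : open G).

Let nearG p : G p -> \forall x \near p, G x.
Proof. by move=> Gp; exact: open_nbhs_nbhs. Qed.

Lemma eq_mxcont_on k l (F H : R * R -> 'M[R[i]]_(k, l)) :
  (forall p, G p -> F p = H p) -> mxcont_on G F -> mxcont_on G H.
Proof.
move=> FH cF p Gp; rewrite -FH //; apply: near_eq_mxcvg (cF p Gp).
by apply: filterS (nearG Gp) => x /FH.
Qed.

Lemma regular_intro k l (F F' : R * R -> 'M[R[i]]_(k, l)) :
  (forall p, G p -> is_pderive v F p (F' p)) -> mxcont_on G F ->
  mxcont_on G F' -> regular_on v G F.
Proof.
move=> dF cF cF'; split => // [p /dF[]//|].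
by apply: eq_mxcont_on cF' => p /dF[_ ->].
Qed.

Lemma regular_pderive k l (F : R * R -> 'M[R[i]]_(k, l)) p :
  regular_on v G F -> G p -> is_pderive v F p (pderive v F p).
Proof. by move=> [dF _ _] Gp; split => //; exact: dF. Qed.

Lemma eq_regular k l (F H : R * R -> 'M[R[i]]_(k, l)) :
  (forall p, G p -> F p = H p) -> regular_on v G F -> regular_on v G H.
Proof.
move=> FH rF; have [dF cF cF'] := rF.
apply: (@regular_intro _ _ _ (pderive v F)) => //.
- move=> p Gp; apply: near_eq_is_pderive (regular_pderive rF Gp).
  by apply: filterS (nearG Gp) => x /FH.
- exact: eq_mxcont_on cF.
Qed.

Lemma regular_cst k l (L : 'M[R[i]]_(k, l)) : regular_on v G (fun=> L).
Proof.
apply: (@regular_intro _ _ _ (fun=> 0)) => p _; first exact: is_pderive_cst.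
- exact: mxcvg_cst.
- exact: mxcvg_cst.
Qed.

Lemma regularD k l (F H : R * R -> 'M[R[i]]_(k, l)) :
  regular_on v G F -> regular_on v G H -> regular_on v G (fun x => F x + H x).
Proof.
move=> rF rH; have [dF cF cF'] := rF; have [dH cH cH'] := rH.
apply: (@regular_intro _ _ _ (fun x => pderive v F x + pderive v H x)) => p Gp.
- by apply: is_pderiveD; exact: regular_pderive.
- by apply: mxcvgD; [exact: cF|exact: cH].
- by apply: mxcvgD; [exact: cF'|exact: cH'].
Qed.

Lemma regularZ k l c (F : R * R -> 'M[R[i]]_(k, l)) :
  regular_on v G F -> regular_on v G (fun x => c *: F x).
Proof.
move=> rF; have [dF cF cF'] := rF.
apply: (@regular_intro _ _ _ (fun x => c *: pderive v F x)) => p Gp.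
- by apply: is_pderiveZ; exact: regular_pderive.
- by apply: mxcvgZ; [exact: ccvg_cst|exact: cF].
- by apply: mxcvgZ; [exact: ccvg_cst|exact: cF'].
Qed.

Lemma regularN k l (F : R * R -> 'M[R[i]]_(k, l)) :
  regular_on v G F -> regular_on v G (fun x => - F x).
Proof.
move=> /(regularZ (-1)); apply: eq_regular => p _; exact: scaleN1r.
Qed.

Lemma regularB k l (F H : R * R -> 'M[R[i]]_(k, l)) :
  regular_on v G F -> regular_on v G H -> regular_on v G (fun x => F x - H x).
Proof. by move=> rF /regularN; exact: regularD. Qed.

Lemma regularM k l n (F : R * R -> 'M[R[i]]_(k, l)) (H : R * R -> 'M[R[i]]_(l, n)) :
  regular_on v G F -> regular_on v G H -> regular_on v G (fun x => F x *m H x).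
Proof.
move=> rF rH; have [dF cF cF'] := rF; have [dH cH cH'] := rH.
apply: (@regular_intro _ _ _
  (fun x => pderive v F x *m H x + F x *m pderive v H x)) => p Gp.
- by apply: is_pderiveM; exact: regular_pderive.
- by apply: mxcvgM; [exact: cF|exact: cH].
- by apply: mxcvgD; apply: mxcvgM; [exact: cF'|exact: cH|exact: cF|exact: cH'].
Qed.

Lemma regular_adj k l (F : R * R -> 'M[R[i]]_(k, l)) :
  regular_on v G F -> regular_on v G (fun x => (F x)^t*).
Proof.
move=> rF; have [dF cF cF'] := rF.
apply: (@regular_intro _ _ _ (fun x => (pderive v F x)^t*)) => p Gp.
- by apply: is_pderive_adj; exact: regular_pderive.
- by apply: mxcvg_adj; exact: cF.
- by apply: mxcvg_adj; exact: cF'.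
Qed.

Lemma regular_inv k (F : R * R -> 'M[R[i]]_k) :
  (forall p, G p -> F p \in unitmx) ->
  regular_on v G F -> regular_on v G (fun x => invmx (F x)).
Proof.
move=> uF rF; have [dF cF cF'] := rF.
apply: (@regular_intro _ _ _
  (fun x => - (invmx (F x) *m pderive v F x *m invmx (F x)))) => p Gp.
- by apply: is_pderive_inv; [exact: uF|exact: regular_pderive].
- by apply: mxcvg_inv; [exact: uF|exact: cF].
- have ci : mxcvg (nbhs p) (fun x => invmx (F x)) (invmx (F p)).
    by apply: mxcvg_inv; [exact: uF|exact: cF].
  exact: (mxcvgN (mxcvgM (mxcvgM ci (cF' p Gp)) ci)).
Qed.

Lemma regular_dressed m n (J : 'M[R[i]]_m) (A S : R * R -> 'M[R[i]]_n)
    (Pi : R * R -> 'M[R[i]]_(n, m)) (q : R * R -> 'M[R[i]]_m) (c : R * R -> R) :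
  (forall p, G p -> A p - 1%:M \in unitmx) -> (forall p, G p -> S p \in unitmx) ->
  regular_on v G A -> regular_on v G S -> regular_on v G Pi ->
  regular_on v G q ->
  regular_on v G (fun x => ((c x)%:C)%:M : 'M[R[i]]_m) ->
  regular_on v G (fun x => dressed J A Pi S (q x) (c x)%:C x).
Proof.
move=> uA uS rA rS rPi rq rc.
have rPis := regular_adj rPi.
have rB : regular_on v G (fun x => invmx (A x - 1%:M)).
  exact: (regular_inv uA (regularB rA (regular_cst 1%:M))).
have rBs : regular_on v G (fun x => invmx ((A x)^t* - 1%:M)).
  apply: regular_inv; first by move=> p /uA; rewrite -ctrmx_unit ctrmxD ctrmxN ctrmx1 trmxCK.
  by apply: regularB; [exact: regular_adj|exact: regular_cst].
have rT := regular_inv uS rS.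
have rJP := regularM (regular_cst J) rPis.
have ry := regularM rJP rT.
have r1 := regular_cst (1%:M : 'M[R[i]]_m).
have rWi := regularD r1 (regularZ 'i (regularM (regularM (regularM rJP rBs) rT) rPi)).
have rW := regularB r1 (regularZ 'i (regularM (regularM ry rB) rPi)).
have rW' := regularN (regularZ 'i (regularM (regularM (regularM ry rB) rB) rPi)).
have r2 := regularZ 2 (regularM rc (regularM rW' rWi)).
apply: eq_regular (regularD (regularM (regularM rW rq) rWi) r2) => p _.
by rewrite /dressed mul_scalar_mx scalerA.
Qed.

End Regular.

(** * The separated function alpha = f(xi) + h(eta) *)

Section SeparatedVariables.
Context {R : realType}.
Implicit Types (f h g : R -> R) (p : R * R).

Lemma is_derive_fst f p (f' : R) : is_derive p.1 1 f f' ->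
  is_derive p dir_xi (fun x => f x.1) f'.
Proof.
have E : (fun k : R => k^-1 *: (((fun x => f x.1) \o shift p) (k *: dir_xi) - f p.1)) =
         (fun k : R => k^-1 *: ((f \o shift p.1) (k *: 1) - f p.1)).
  by apply/funext => k.
by move=> [d1 d2]; split; rewrite /derivable /derive E.
Qed.

Lemma is_derive_snd f p (f' : R) : is_derive p.2 1 f f' ->
  is_derive p dir_eta (fun x => f x.2) f'.
Proof.
have E : (fun k : R => k^-1 *: (((fun x => f x.2) \o shift p) (k *: dir_eta) - f p.2)) =
         (fun k : R => k^-1 *: ((f \o shift p.2) (k *: 1) - f p.2)).
  by apply/funext => k.
by move=> [d1 d2]; split; rewrite /derivable /derive E.
Qed.

Lemma is_derive_fst_eta g p : is_derive p dir_eta (fun x => g x.1) 0.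
Proof.
have E : (fun k : R => k^-1 *: (((fun x => g x.1) \o shift p) (k *: dir_eta) - g p.1)) =
         (fun=> 0).
  by apply/funext => k; rewrite /= [k *: 0]mulr0 add0r subrr scaler0.
by split; rewrite /derivable /derive E; [exact: is_cvg_cst|exact: lim_cst].
Qed.

Lemma is_derive_snd_xi g p : is_derive p dir_xi (fun x => g x.2) 0.
Proof.
have E : (fun k : R => k^-1 *: (((fun x => g x.2) \o shift p) (k *: dir_xi) - g p.2)) =
         (fun=> 0).
  by apply/funext => k; rewrite /= [k *: 0]mulr0 add0r subrr scaler0.
by split; rewrite /derivable /derive E; [exact: is_cvg_cst|exact: lim_cst].
Qed.

Lemma C1_at_is_derive f x : C1_at f x -> is_derive x 1 f (derive1 f x).
Proof.
move=> [df _]; split; first exact: nbhs_singleton df.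
by rewrite derive1E.
Qed.

Context (D : set (R * R)) (D_open : open D) (alpha : R * R -> R) (f h : R -> R).
Hypotheses (alphaE : forall p, D p -> alpha p = f p.1 + h p.2)
  (f_C1 : forall p, D p -> C1_at f p.1) (h_C1 : forall p, D p -> C1_at h p.2).

Let nearD p : D p -> \forall x \near p, D x.
Proof. by move=> Dp; exact: open_nbhs_nbhs. Qed.

Lemma is_derive_separated_xi p : D p -> is_derive p dir_xi alpha (derive1 f p.1).
Proof.
move=> Dp; apply: (@near_eq_is_derive _ _ _ (fun x => f x.1 + h x.2)).
  by apply: filterS (nearD Dp) => x /alphaE.
rewrite -[derive1 f _]addr0; apply: is_deriveD; last exact: is_derive_snd_xi.
exact/is_derive_fst/C1_at_is_derive/f_C1.
Qed.

Lemma is_derive_separated_eta p : D p -> is_derive p dir_eta alpha (derive1 h p.2).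
Proof.
move=> Dp; apply: (@near_eq_is_derive _ _ _ (fun x => f x.1 + h x.2)).
  by apply: filterS (nearD Dp) => x /alphaE.
rewrite -[derive1 h _]add0r; apply: is_deriveD; first exact: is_derive_fst_eta.
exact/is_derive_snd/C1_at_is_derive/h_C1.
Qed.

Lemma C1_at_cvg g x : C1_at g x -> g @ x --> g x.
Proof.
move=> /C1_at_is_derive[dg _].
exact/differentiable_continuous/derivable1_diffP.
Qed.

Lemma cvg_compose_fst g p : {for p.1, continuous g} ->
  (fun x : R * R => g x.1) @ p --> g p.1.
Proof.
move=> cg; apply: (@cvg_comp _ _ _ fst g _ (nbhs p.1)) => // P /nbhs_ballP[e /= e0 eP].
by apply/nbhs_boxP; exists e => // x x1 _; apply: eP; rewrite /ball /= distrC.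
Qed.

Lemma cvg_compose_snd g p : {for p.2, continuous g} ->
  (fun x : R * R => g x.2) @ p --> g p.2.
Proof.
move=> cg; apply: (@cvg_comp _ _ _ snd g _ (nbhs p.2)) => // P /nbhs_ballP[e /= e0 eP].
by apply/nbhs_boxP; exists e => // x _ x2; apply: eP; rewrite /ball /= distrC.
Qed.

Lemma cvg_separated p : D p -> alpha @ p --> alpha p.
Proof.
move=> Dp; rewrite alphaE //.
apply: (@cvg_trans _ ((fun x => f x.1 + h x.2) @ p)).
  by apply: near_eq_cvg; apply: filterS (nearD Dp) => x /alphaE.
have cf := cvg_compose_fst (C1_at_cvg (f_C1 Dp)).
have ch := cvg_compose_snd (C1_at_cvg (h_C1 Dp)).
exact: (cvgD cf ch).
Qed.

Lemma mxcont_separated k : mxcont_on D (fun x => ((alpha x)%:C)%:M : 'M[R[i]]_k).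
Proof. by move=> p Dp; apply: mxcvg_scalar; apply: ccvg_real; exact: cvg_separated. Qed.

Lemma mxcont_derive_fst k :
  mxcont_on D (fun x => ((derive1 f x.1)%:C)%:M : 'M[R[i]]_k).
Proof.
move=> p Dp; apply: mxcvg_scalar; apply: ccvg_real.
by apply: cvg_compose_fst; have [] := f_C1 Dp.
Qed.

Lemma mxcont_derive_snd k :
  mxcont_on D (fun x => ((derive1 h x.2)%:C)%:M : 'M[R[i]]_k).
Proof.
move=> p Dp; apply: mxcvg_scalar; apply: ccvg_real.
by apply: cvg_compose_snd; have [] := h_C1 Dp.
Qed.

Lemma regular_separated_xi k :
  regular_on dir_xi D (fun x => ((alpha x)%:C)%:M : 'M[R[i]]_k).
Proof.
apply: (regular_intro D_open _ (@mxcont_separated k) (@mxcont_derive_fst k)) => p Dp.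
exact/is_pderive_real/is_derive_separated_xi.
Qed.

Lemma regular_separated_eta k :
  regular_on dir_eta D (fun x => ((alpha x)%:C)%:M : 'M[R[i]]_k).
Proof.
apply: (regular_intro D_open _ (@mxcont_separated k) (@mxcont_derive_snd k)) => p Dp.
exact/is_pderive_real/is_derive_separated_eta.
Qed.

(** The effect of alpha_xi_eta = 0: f' is constant in eta, so no second derivative of f is called
    for. *)
Lemma regular_derive_fst k :
  regular_on dir_eta D (fun x => ((derive1 f x.1)%:C)%:M : 'M[R[i]]_k).
Proof.
apply: (@regular_intro _ _ _ D_open _ _ _ (fun=> 0%:C%:M)) => [p _||p _].
- exact/is_pderive_real/is_derive_fst_eta.
- exact: mxcont_derive_fst.
- exact: mxcvg_cst.
Qed.

Lemma regular_derive_snd k :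
  regular_on dir_xi D (fun x => ((derive1 h x.2)%:C)%:M : 'M[R[i]]_k).
Proof.
apply: (@regular_intro _ _ _ D_open _ _ _ (fun=> 0%:C%:M)) => [p _||p _].
- exact/is_pderive_real/is_derive_snd_xi.
- exact: mxcont_derive_snd.
- exact: mxcvg_cst.
Qed.

End SeparatedVariables.

(** * The dressed solution *)

Lemma pderive0_on {R : realType} (D : set (R * R)) k l
    (F : R * R -> 'M[R[i]]_(k, l)) p0 p :
  open D -> connected D -> D p0 ->
  (forall x, D x -> is_pderive dir_xi F x 0) ->
  (forall x, D x -> is_pderive dir_eta F x 0) -> D p -> F p = F p0.
Proof.
move=> Do Dc Dp0 Fx Fy; move: p.
apply: (@connected_lines _ D (fun p => F p = F p0) p0) => // v vE p r Dr <-.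
by apply: pderive0_line => s /Dr; case: vE => ->; [exact: Fx|exact: Fy].
Qed.

(** * Limits of the velocities along filters finer than neighbourhoods *)

Section FlowLimits.
Context {R : realType} {m n : nat} (D : set (R * R)) (D_open : open D).
Variables (v : R * R) (J : 'M[R[i]]_m) (a : R * R -> R) (q : R * R -> 'M[R[i]]_m).
Variables (A S : R * R -> 'M[R[i]]_n) (Pi : R * R -> 'M[R[i]]_(n, m)).
Hypothesis flow : forall p, D p -> dressing_flow v J (q p) (a p) A Pi S p.
Hypothesis a_cont : forall p, D p -> a @ p --> a p.
Hypothesis q_cont : mxcont_on D q.

Let AmI_unit p : D p -> A p - 1%:M \in unitmx.
Proof. by move=> /flow/flow_unit. Qed.

Section GraphLimits.
Variables (Phi : set_system (R * R)) (FPhi : Filter Phi) (p : R * R).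
Hypotheses (Dp : D p) (nbhs_Phi : nbhs p `<=` Phi).

(** [Phi] will be the graph filter while joint continuity is being proved, and [nbhs p] itself once
    it is known. *)
Lemma ccvg_coef : ccvg Phi (fun x => (a x)%:C) (a p)%:C.
Proof. by apply: ccvg_real => P /(a_cont Dp)/nbhs_Phi. Qed.

Let qPhi : mxcvg Phi q (q p). Proof. exact: mxcvg_finer (q_cont Dp). Qed.

Hypothesis cA : mxcvg Phi A (A p).

Lemma mxcvg_resolvent : mxcvg Phi (fun x => invmx (A x - 1%:M)) (invmx (A p - 1%:M)).
Proof. exact: (mxcvg_inv (AmI_unit Dp) (mxcvgB cA (mxcvg_cst _))). Qed.

Lemma mxcvg_flow_A : mxcvg Phi (fun x => - (a x)%:C *: A x - (2 * (a x)%:C) *: 1%:M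
    - (2 * (a x)%:C) *: invmx (A x - 1%:M))
  (- (a p)%:C *: A p - (2 * (a p)%:C) *: 1%:M - (2 * (a p)%:C) *: invmx (A p - 1%:M)).
Proof.
have c2 : ccvg Phi (fun x => 2 * (a x)%:C) (2 * (a p)%:C).
  exact: ccvgM (ccvg_cst 2) ccvg_coef.
exact: (mxcvgB (mxcvgB (mxcvgZ (ccvgN ccvg_coef) cA) (mxcvgZ c2 (mxcvg_cst _)))
  (mxcvgZ c2 mxcvg_resolvent)).
Qed.

Hypothesis cPi : mxcvg Phi Pi (Pi p).

Lemma mxcvg_flow_Pi : mxcvg Phi (fun x => invmx (A x - 1%:M) *m Pi x *m q x)
  (invmx (A p - 1%:M) *m Pi p *m q p).
Proof. exact: (mxcvgM (mxcvgM mxcvg_resolvent cPi) qPhi). Qed.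

Hypothesis cS : mxcvg Phi S (S p).

Lemma mxcvg_flow_S : mxcvg Phi (fun x =>
    (a x)%:C *: (S x - 2 *: (invmx (A x - 1%:M) *m S x *m invmx ((A x)^t* - 1%:M)))
     - 'i *: (invmx (A x - 1%:M) *m Pi x *m q x *m J *m (Pi x)^t*
              *m invmx ((A x)^t* - 1%:M)))
    ((a p)%:C *: (S p - 2 *: (invmx (A p - 1%:M) *m S p *m invmx ((A p)^t* - 1%:M)))
     - 'i *: (invmx (A p - 1%:M) *m Pi p *m q p *m J *m (Pi p)^t*
              *m invmx ((A p)^t* - 1%:M))).
Proof.
have uAs : (A p)^t* - 1%:M \in unitmx.
  by have := AmI_unit Dp; rewrite -ctrmx_unit ctrmxD ctrmxN ctrmx1.
have cBs : mxcvg Phi (fun x => invmx ((A x)^t* - 1%:M)) (invmx ((A p)^t* - 1%:M)).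
  exact: mxcvg_inv uAs (mxcvgB (mxcvg_adj cA) (mxcvg_cst _)).
have cB := mxcvg_resolvent.
exact: (mxcvgB (mxcvgZ ccvg_coef (mxcvgB cS (mxcvgZ (ccvg_cst 2)
    (mxcvgM (mxcvgM cB cS) cBs))))
  (mxcvgZ (ccvg_cst 'i) (mxcvgM (mxcvgM (mxcvgM (mxcvgM (mxcvgM cB cPi) qPhi)
    (mxcvg_cst J)) (mxcvg_adj cPi)) cBs))).
Qed.

End GraphLimits.

Lemma regular_flow : mxcont_on D A -> mxcont_on D Pi -> mxcont_on D S ->
  [/\ regular_on v D A, regular_on v D Pi & regular_on v D S].
Proof.
move=> A_cont Pi_cont S_cont; split.
- apply: (regular_intro D_open (fun p Dp => flow_A (flow Dp)) A_cont) => p Dp.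
  by apply: mxcvg_flow_A => //; exact: A_cont.
- apply: (regular_intro D_open (fun p Dp => flow_Pi (flow Dp)) Pi_cont) => p Dp.
  by apply: mxcvg_flow_Pi => //; [exact: A_cont|exact: Pi_cont].
- apply: (regular_intro D_open (fun p Dp => flow_S (flow Dp)) S_cont) => p Dp.
  by apply: mxcvg_flow_S => //; [exact: A_cont|exact: Pi_cont|exact: S_cont].
Qed.

End FlowLimits.

Lemma logder_eq {R : realType} m v (w : R * R -> 'M[R[i]]_m) p L :
  w p \in unitmx -> is_pderive v w p (L *m w p) -> logder v w p = L.
Proof. by move=> wu [_ E]; rewrite /logder E mulmxK. Qed.

Section Dressing.
Context {R : realType} {m n : nat} (D : set (R * R)).
Hypotheses (D_open : open D) (D_conn : connected D) (D0 : D (0, 0)).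
Variables (J : 'M[R[i]]_m) (alpha a b : R * R -> R) (q r : R * R -> 'M[R[i]]_m).
Variables (A S : R * R -> 'M[R[i]]_n) (Pi : R * R -> 'M[R[i]]_(n, m)).
Hypotheses (J_herm : J = J^t*) (JJ : J *m J = 1%:M).
Hypothesis flow_xi : forall p, D p -> dressing_flow dir_xi J (q p) (a p) A Pi S p.
(* The change of signs (A, S, Q) -> (- A, - S, - Q) turns the eta-equations into
   the xi-equations and leaves the Darboux matrix unchanged. *)
Hypothesis flow_eta : forall p, D p ->
  dressing_flow dir_eta J (r p) (b p) (fun x => - A x) Pi (fun x => - S x) p.
Hypothesis alpha_neq0 : forall p, D p -> alpha p != 0.
Hypothesis alpha_xi : forall p, D p -> is_derive p dir_xi alpha (alpha p * a p).
Hypothesis alpha_eta : forall p, D p -> is_derive p dir_eta alpha (alpha p * b p).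
Hypothesis S0_herm : S (0, 0) = (S (0, 0))^t*.
Hypothesis sylvester0 : A (0, 0) *m S (0, 0) - S (0, 0) *m (A (0, 0))^t* =
  'i *: (Pi (0, 0) *m J *m (Pi (0, 0))^t*).

Let AmI_unit p : D p -> A p - 1%:M \in unitmx.
Proof. by move=> /flow_xi/flow_unit. Qed.

Let ApI_unit p : D p -> A p + 1%:M \in unitmx.
Proof. by move=> /flow_eta/flow_unit; rewrite -opprD unitmx_opp. Qed.

Lemma sylvester_on p : D p ->
  A p *m S p - S p *m (A p)^t* = 'i *: (Pi p *m J *m (Pi p)^t*).
Proof.
move=> Dp; apply/eqP; rewrite -subr_eq0; apply/eqP.
rewrite (@pderive0_on _ D _ _ (fun x => A x *m S x - S x *m (A x)^t*
  - 'i *: (Pi x *m J *m (Pi x)^t*)) (0, 0) p) ?sylvester0 ?subrr //.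
- by move=> x /flow_xi; exact: sylvester_flow.
- move=> x /flow_eta/sylvester_flow.
  apply: near_eq_is_pderive.
  by apply: (@filterE _ (nbhs x) (nbhs_filter x)) => y; rewrite sylvester_opp.
Qed.

(** The right side of the Sylvester identity is anti-selfadjoint, so S^* solves the same equation as
    S; subtract the two. *)
Let sylvester_adj p : D p ->
  A p *m (S p - (S p)^t*) = (S p - (S p)^t*) *m (A p)^t*.
Proof.
move=> Dp; have E := sylvester_on Dp.
have EL : (A p *m S p - S p *m (A p)^t*)^t* =
    - (A p *m (S p)^t* - (S p)^t* *m (A p)^t*).
  by rewrite ctrmxD ctrmxN (ctrmxM (A p)) (ctrmxM (S p)) trmxCK opprB.
have ER : ('i *: (Pi p *m J *m (Pi p)^t*))^t* = - ('i *: (Pi p *m J *m (Pi p)^t*)).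
  by rewrite ctrmxZ conj_i scaleNr 2!ctrmxM trmxCK -J_herm mulmxA.
rewrite E ER in EL; move/oppr_inj/esym/eqP: EL; rewrite subr_eq => /eqP E'.
move/eqP: E; rewrite subr_eq => /eqP E.
by rewrite mulmxBr mulmxBl E E' opprD addrACA subrr add0r.
Qed.

Let factor_unit (X : 'M[R[i]]_n) : X - 1%:M \in unitmx -> X + 1%:M \in unitmx ->
  hermite_factor X (invmx (X - 1%:M)) \in unitmx.
Proof.
move=> Xm Xp; rewrite (hermite_factorE (mulmxV Xm)).
by rewrite !unitmx_mul Xp unitmx_inv Xm.
Qed.

Let scaled_factor_inj p (X Z : 'M[R[i]]_n) : D p ->
  X - 1%:M \in unitmx -> X + 1%:M \in unitmx ->
  ((alpha p)%:C)%:M *m (hermite_factor X (invmx (X - 1%:M)) *m Z) = 0 -> Z = 0.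
Proof.
move=> Dp Xm Xp; rewrite mul_scalar_mx => /eqP; rewrite scaler_eq0.
have -> /= : ((alpha p)%:C == 0) = false.
  by rewrite -(rmorph0 (real_complex R)) (inj_eq (@complexI R)) (negbTE (alpha_neq0 Dp)).
by move=> /eqP /(congr1 (mulmx (invmx (hermite_factor X (invmx (X - 1%:M))))));
  rewrite mulKmx ?mulmx0 // factor_unit.
Qed.

(** The integrating factors in xi and in eta differ, one being built from A and the other from - A,
    so no single quantity is shown constant on D. Instead the property S = S^* is carried along each
    axis-parallel segment with the factor of its own direction. *)
Lemma hermitian_on p : D p -> S p = (S p)^t*.
Proof.
move=> Dp; apply/eqP; rewrite -subr_eq0; apply/eqP; move: p Dp.
apply: (@connected_lines _ D (fun p => S p - (S p)^t* = 0) (0, 0)) => //.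
  by rewrite -S0_herm subrr.
move=> v [->|->] p t Dt Z0.
  have Dpt : D (t *: dir_xi + p) by exact: Dt.
  apply: (scaled_factor_inj Dpt (AmI_unit Dpt) (ApI_unit Dpt)).
  rewrite (@pderive0_line _ _ _ dir_xi (fun x => ((alpha x)%:C)%:M *m
    (hermite_factor (A x) (invmx (A x - 1%:M)) *m (S x - (S x)^t*)))).
    by rewrite Z0 !mulmx0.
  move=> s /Dt Ds; apply: (hermite_flow (flow_xi Ds)) => //; first exact: alpha_xi.
  exact: sylvester_adj.
have Dpt : D (t *: dir_eta + p) by exact: Dt.
have NZ x : - S x - (- S x)^t* = - (S x - (S x)^t*) by rewrite ctrmxN opprD.
apply: oppr_inj; rewrite oppr0.
apply: (@scaled_factor_inj _ (- A (t *: dir_eta + p)) _ Dpt).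
- by rewrite -opprD unitmx_opp; exact: ApI_unit.
- by rewrite addrC -opprB unitmx_opp; exact: AmI_unit.
rewrite -NZ (@pderive0_line _ _ _ dir_eta (fun x => ((alpha x)%:C)%:M *m
    (hermite_factor (- A x) (invmx (- A x - 1%:M)) *m (- S x - (- S x)^t*)))).
  by rewrite NZ Z0 oppr0 !mulmx0.
move=> s /Dt Ds; apply: (hermite_flow (flow_eta Ds)) => //; first exact: alpha_eta.
by rewrite NZ ctrmxN !mulmxN !mulNmx !opprK; exact: sylvester_adj.
Qed.

Hypotheses (a_cont : forall p, D p -> a @ p --> a p)
  (b_cont : forall p, D p -> b @ p --> b p).
Hypotheses (q_cont : mxcont_on D q) (r_cont : mxcont_on D r).

Let nearD p : D p -> \forall x \near p, D x.
Proof. by move=> Dp; exact: open_nbhs_nbhs. Qed.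

Let joint k l (F F' : R * R -> 'M[R[i]]_(k, l)) :
  (forall p, D p -> is_pderive dir_xi F p (F' p)) ->
  (forall p, D p -> exists G, is_pderive dir_eta F p G) ->
  (forall p, D p -> mxcvg (graph_nbhs F p) F' (F' p)) -> mxcont_on D F.
Proof.
move=> Fx Fy cF' p Dp; have [G Fyp] := Fy p Dp.
apply: (mxcvg_joint _ Fyp (cF' p Dp)).
by apply: filterS (nearD Dp) => x /Fx.
Qed.

Let finer k l (F : R * R -> 'M[R[i]]_(k, l)) p : nbhs p `<=` graph_nbhs F p.
Proof. by move=> P nP; exact: graph_nbhs_finer. Qed.

Let is_pderiveNK k l v (F : R * R -> 'M[R[i]]_(k, l)) p G :
  is_pderive v (fun x => - F x) p G -> is_pderive v F p (- G).
Proof. by move=> /is_pderiveN; under eq_fun do rewrite opprK. Qed.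

(** The system is triangular: the velocity of A involves A alone, that of Pi involves A and Pi, that
    of S all three. Hence continuity is proved in this order. *)
Lemma A_cont : mxcont_on D A.
Proof.
apply: joint => [p /flow_xi/flow_A dA|p /flow_eta/flow_A/is_pderiveNK dA|p Dp].
- exact: dA.
- by eexists; exact: dA.
- apply: (mxcvg_flow_A flow_xi) => //; [exact: graph_nbhs_filter|exact: mxcvg_graph].
Qed.

Lemma Pi_cont : mxcont_on D Pi.
Proof.
apply: joint => [p /flow_xi/flow_Pi dP|p /flow_eta/flow_Pi dP|p Dp].
- exact: dP.
- by eexists; exact: dP.
- apply: (mxcvg_flow_Pi flow_xi) => //; first exact: graph_nbhs_filter.
    exact: mxcvg_finer (A_cont Dp).
  exact: mxcvg_graph.
Qed.

Lemma S_cont : mxcont_on D S.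
Proof.
apply: joint => [p /flow_xi/flow_S dS|p /flow_eta/flow_S/is_pderiveNK dS|p Dp].
- exact: dS.
- by eexists; exact: dS.
- apply: (mxcvg_flow_S flow_xi) => //; first exact: graph_nbhs_filter.
  + exact: mxcvg_finer (A_cont Dp).
  + exact: mxcvg_finer (Pi_cont Dp).
  + exact: mxcvg_graph.
Qed.

Lemma regular_xi :
  [/\ regular_on dir_xi D A, regular_on dir_xi D Pi & regular_on dir_xi D S].
Proof. exact: (regular_flow D_open flow_xi a_cont q_cont A_cont Pi_cont S_cont). Qed.

Lemma regular_eta :
  [/\ regular_on dir_eta D (fun x => - A x), regular_on dir_eta D Pi &
      regular_on dir_eta D (fun x => - S x)].
Proof.
apply: (regular_flow D_open flow_eta b_cont r_cont) => p Dp.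
- by apply: mxcvgN; exact: A_cont.
- exact: Pi_cont.
- by apply: mxcvgN; exact: S_cont.
Qed.

Variable u : R * R -> 'M[R[i]]_m.
Hypotheses (u_xi : forall p, D p -> is_pderive dir_xi u p (q p *m u p))
  (u_eta : forall p, D p -> is_pderive dir_eta u p (r p *m u p)).
Hypotheses (u_unit : forall p, D p -> u p \in unitmx) (u0 : u (0, 0) = 1%:M).

Let u_isometry_derive v w p : J *m w = - (w^t* *m J) ->
  is_pderive v u p (w *m u p) ->
  is_pderive v (fun x => (u x)^t* *m J *m u x) p 0.
Proof.
move=> Jw du.
apply: is_pderive_eq (is_pderiveM (is_pderiveM (is_pderive_adj du)
  (is_pderive_cst v p J)) du) _.
rewrite mulmx0 addr0 ctrmxM mulmxA -[_ *m J *m w]mulmxA Jw mulmxN mulNmx !mulmxA.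
by rewrite subrr.
Qed.

Let skew_adj (w : 'M[R[i]]_m) : w *m J = - (J *m w^t*) -> J *m w = - (w^t* *m J).
Proof.
move=> wJ; rewrite -[LHS]mulmx1 -JJ mulmxA -[J *m w *m J]mulmxA wJ.
by rewrite mulmxN mulNmx !mulmxA JJ mul1mx.
Qed.

Lemma u_isometry p : D p -> (u p)^t* *m J *m u p = J.
Proof.
move=> Dp; rewrite (@pderive0_on _ D _ _ (fun x => (u x)^t* *m J *m u x) (0, 0) p) //.
- by rewrite u0 ctrmx1 mul1mx mulmx1.
- move=> x Dx; apply: u_isometry_derive (u_xi Dx).
  exact/skew_adj/(flow_skew (flow_xi Dx)).
- move=> x Dx; apply: u_isometry_derive (u_eta Dx).
  exact/skew_adj/(flow_skew (flow_eta Dx)).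
Qed.

Let G : set (R * R) := [set p | [/\ D p, S p \in unitmx & A p \in unitmx]]%classic.
Let uhat x := darboux J A Pi S x *m u x.

Lemma uhat_isometry p : G p -> (uhat p)^t* *m J *m uhat p = J.
Proof.
move=> [Dp Su Au]; rewrite /uhat ctrmxM.
have GAs : invmx ((A p)^t*) *m (A p)^t* = 1%:M by rewrite mulVmx // ctrmx_unit.
have Uadj : (darboux J A Pi S p)^t* = 1%:M + 'i *: ((Pi p)^t* *m invmx ((A p)^t*)
    *m invmx (S p) *m Pi p *m J).
  rewrite /darboux ctrmx_darboux (ctrmx_inv (A p)) (ctrmx_inv (S p)).
  by rewrite -(hermitian_on Dp) -J_herm.
have H := darboux_isometry ii_N1 (mulVmx Su) (mulmxV Su) (mulmxV Au)
  (sylvester_on Dp) GAs JJ.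
rewrite -[RHS](u_isometry Dp) -[X in _ = _ *m X *m _]H -Uadj /darboux.
by rewrite !mulmxA.
Qed.

(** The invertibility demanded by [satisfies_eq] is drawn from J-unitarity. *)
Lemma uhat_unit p : G p -> uhat p \in unitmx.
Proof.
move=> /uhat_isometry E; have : J \in unitmx by case/mulmx1_unit: JJ.
by rewrite -{1}E unitmx_mul => /andP[].
Qed.

(** Another use of joint continuity: identities on G can be differentiated only because G is
    open. *)
Lemma G_open : open G.
Proof.
rewrite openE => p [Dp Su Au].
have nS : \forall x \near p, S x \in unitmx by exact: mxcvg_unit Su (S_cont Dp).
have nA : \forall x \near p, A x \in unitmx by exact: mxcvg_unit Au (A_cont Dp).
by apply: filterS3 (nearD Dp) nS nA => x; split.
Qed.

Let nearG p : G p -> \forall x \near p, G x.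
Proof. by move=> Gp; exact: open_nbhs_nbhs (conj G_open Gp). Qed.

Let qh x := dressed J A Pi S (q x) (a x)%:C x.
Let rh x := dressed J (fun x => - A x) Pi (fun x => - S x) (r x) (b x)%:C x.

Lemma uhat_xi p : G p -> is_pderive dir_xi uhat p (qh p *m uhat p).
Proof.
move=> [Dp Su Au].
apply: is_pderive_eq (is_pderiveM (darboux_flow (flow_xi Dp) Au Su (sylvester_on Dp))
  (u_xi Dp)) _.
by rewrite mulmxBl !mulmxA subrK.
Qed.

Let darbouxN : darboux J (fun x => - A x) Pi (fun x => - S x) = darboux J A Pi S.
Proof. by apply/funext => x; rewrite /darboux !invmx_opp !mulmxN !mulNmx opprK. Qed.

Let sylvesterN p : D p ->
  - A p *m - S p - - S p *m (- A p)^t* = 'i *: (Pi p *m J *m (Pi p)^t*).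
Proof. by move=> Dp; rewrite sylvester_opp; exact: sylvester_on. Qed.

Lemma uhat_eta p : G p -> is_pderive dir_eta uhat p (rh p *m uhat p).
Proof.
move=> [Dp Su Au]; rewrite /uhat -darbouxN.
rewrite -unitmx_opp in Su; rewrite -unitmx_opp in Au.
apply: is_pderive_eq (is_pderiveM (darboux_flow (flow_eta Dp) Au Su (sylvesterN Dp))
  (u_eta Dp)) _.
by rewrite mulmxBl !mulmxA subrK.
Qed.

Let M x : 'M[R[i]]_m :=
  ((alpha x)%:C)%:M *m (J *m (Pi x)^t* *m invmx (S x) *m Pi x).
Let Mx x := ('i * (alpha x)%:C) *: (qh x - q x).
Let My x := - (('i * (alpha x)%:C) *: (rh x - r x)).

Lemma moment_xi p : G p -> is_pderive dir_xi M p (Mx p).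
Proof.
move=> [Dp Su Au].
exact: (moment_flow (flow_xi Dp) (alpha_xi Dp) Au Su (sylvester_on Dp)).
Qed.

Lemma moment_eta p : G p -> is_pderive dir_eta M p (My p).
Proof.
move=> [Dp Su Au].
rewrite -unitmx_opp in Su; rewrite -unitmx_opp in Au.
have := moment_flow (flow_eta Dp) (alpha_eta Dp) Au Su (sylvesterN Dp).
move=> /is_pderiveN; apply: near_eq_is_pderive.
by apply: filterE => x; rewrite /M invmx_opp !mulmxN mulNmx mulmxN opprK.
Qed.

Let alphaM x : 'M[R[i]]_m := ((alpha x)%:C)%:M.
Hypotheses (alpha_reg_xi : regular_on dir_xi D alphaM)
  (alpha_reg_eta : regular_on dir_eta D alphaM)
  (a_reg : regular_on dir_eta D (fun x => ((alpha x * a x)%:C)%:M : 'M[R[i]]_m))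
  (b_reg : regular_on dir_xi D (fun x => ((alpha x * b x)%:C)%:M : 'M[R[i]]_m))
  (q_reg : regular_on dir_eta D q) (r_reg : regular_on dir_xi D r).
Hypothesis u_eq : forall p, D p ->
  pderive dir_eta (fun x => (alpha x)%:C *: q x) p
  + pderive dir_xi (fun x => (alpha x)%:C *: r x) p = 0.

Let onG v k l (F : R * R -> 'M[R[i]]_(k, l)) : regular_on v D F -> regular_on v G F.
Proof.
by move=> [dF cF cF']; split=> p [Dp _ _]; [exact: dF|exact: cF|exact: cF'].
Qed.

Let regularNK v k l (F : R * R -> 'M[R[i]]_(k, l)) :
  regular_on v D (fun x => - F x) -> regular_on v D F.
Proof.
by move=> rF; apply: (eq_regular D_open _ (regularN D_open rF)) => p _; exact: opprK.
Qed.

(** Moves [alpha] inside: the coefficient a becomes [alpha * a], that is alpha_xi, a function of xi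
    alone, and similarly in eta. *)
Let dressedZ (c : R[i]) A1 S1 Pi1 (w : 'M[R[i]]_m) (e : R[i]) p :
  c *: dressed J A1 Pi1 S1 w e p
    = @dressed R m n J A1 Pi1 S1 (c *: w) (c * e) p.
Proof.
rewrite /dressed scalerDr scalerA mulrCA; congr (_ + _).
by rewrite mulmx_scaler mulmx_scalel.
Qed.

Let aq x := (alpha x)%:C *: q x.
Let ar x := (alpha x)%:C *: r x.

Let aq_reg : regular_on dir_eta D aq.
Proof.
apply: (eq_regular D_open _ (regularM D_open alpha_reg_eta q_reg)) => p _.
exact: mul_scalar_mx.
Qed.

Let ar_reg : regular_on dir_xi D ar.
Proof.
apply: (eq_regular D_open _ (regularM D_open alpha_reg_xi r_reg)) => p _.
exact: mul_scalar_mx.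
Qed.

Lemma regular_aqh : regular_on dir_eta G (fun x => (alpha x)%:C *: qh x).
Proof.
have [rA rPi rS] := regular_eta.
have H := @regular_dressed R dir_eta G G_open m n J A S Pi aq (fun x => alpha x * a x).
apply: (eq_regular G_open _ (H _ _ _ _ _ _ _)) => [p _|p [Dp _ _]|p [_ Su _]|||||].
- by rewrite /qh dressedZ rmorphM.
- exact: AmI_unit.
- exact: Su.
- exact/onG/regularNK.
- exact/onG/regularNK.
- exact: onG.
- exact: onG.
- exact: onG.
Qed.

Lemma regular_arh : regular_on dir_xi G (fun x => (alpha x)%:C *: rh x).
Proof.
have [rA rPi rS] := regular_xi.
have H := @regular_dressed R dir_xi G G_open m n J (fun x => - A x)
  (fun x => - S x) Pi ar (fun x => alpha x * b x).
apply: (eq_regular G_open _ (H _ _ _ _ _ _ _)) => [p _|p [Dp _ _]|p [_ Su _]|||||].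
- by rewrite /rh dressedZ rmorphM.
- exact: (flow_unit (flow_eta Dp)).
- by rewrite unitmx_opp.
- exact/onG/regularN.
- exact/onG/regularN.
- exact: onG.
- exact: onG.
- exact: onG.
Qed.

Let MxE x : Mx x = 'i *: ((alpha x)%:C *: qh x - aq x).
Proof. by rewrite /Mx /aq -scalerBr scalerA. Qed.

Let MyE x : My x = - ('i *: ((alpha x)%:C *: rh x - ar x)).
Proof. by rewrite /My /ar -scalerBr scalerA. Qed.

Lemma mixed_moment p : G p -> pderive dir_eta Mx p = pderive dir_xi My p.
Proof.
move=> Gp.
have rx : regular_on dir_eta G Mx.
  apply: (eq_regular G_open (fun x _ => esym (MxE x))).
  exact: (regularZ G_open 'i (regularB G_open regular_aqh (onG aq_reg))).
have ry : regular_on dir_xi G My.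
  apply: (eq_regular G_open (fun x _ => esym (MyE x))).
  exact: (regularN G_open (regularZ G_open 'i (regularB G_open regular_arh (onG ar_reg)))).
apply: (@eq_mixed_pderive _ _ _ M Mx My).
- by apply: filterS (nearG Gp) => x; exact: moment_xi.
- by apply: filterS (nearG Gp) => x; exact: moment_eta.
- by apply: filterS (nearG Gp) => x; exact: regular_pderive.
- by apply: filterS (nearG Gp) => x; exact: regular_pderive.
- by have [_ _ c] := rx; exact: c.
- by have [_ _ c] := ry; exact: c.
Qed.

Lemma uhat_satisfies_eq : satisfies_eq G alpha uhat.
Proof.
move=> p Gp; have Dp : D p by case: Gp.
pose P x := (alpha x)%:C *: logder dir_xi uhat x.
pose T x := (alpha x)%:C *: logder dir_eta uhat x.
change [/\ uhat p \in unitmx, pderivable dir_xi uhat p /\ pderivable dir_eta uhat p,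
  pderivable dir_eta P p /\ pderivable dir_xi T p &
  pderive dir_eta P p + pderive dir_xi T p = 0].
have PE : \forall x \near p, (alpha x)%:C *: qh x = P x.
  apply: filterS (nearG Gp) => x Gx.
  exact: (congr1 _ (esym (logder_eq (uhat_unit Gx) (uhat_xi Gx)))).
have TE : \forall x \near p, (alpha x)%:C *: rh x = T x.
  apply: filterS (nearG Gp) => x Gx.
  exact: (congr1 _ (esym (logder_eq (uhat_unit Gx) (uhat_eta Gx)))).
have daqh := regular_pderive regular_aqh Gp.
have darh := regular_pderive regular_arh Gp.
have daq := regular_pderive aq_reg Dp.
have dar := regular_pderive ar_reg Dp.
have [dP PeE] := near_eq_is_pderive PE daqh.
have [dT TeE] := near_eq_is_pderive TE darh.
split; [exact: uhat_unit| |by split|].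
  by split; [exact: (uhat_xi Gp).1|exact: (uhat_eta Gp).1].
have [_ dMx] := is_pderiveZ 'i (is_pderiveB daqh daq).
have [_ dMy] := is_pderiveN (is_pderiveZ 'i (is_pderiveB darh dar)).
(* Divided by i, the equality reads [(alpha qh - alpha q)_eta = - (alpha rh - alpha r)_xi]: the left
   sides of the equations for [uhat] and for u coincide. *)
have := mixed_moment Gp.
have -> : Mx = fun x => 'i *: ((alpha x)%:C *: qh x - aq x) by exact/funext.
have -> : My = fun x => - ('i *: ((alpha x)%:C *: rh x - ar x)) by exact/funext.
rewrite dMx dMy PeE TeE -scalerN => /(scalerI (neq0Ci _)) E.
have E' : pderive dir_eta aq p + pderive dir_xi ar p = 0 := u_eq Dp.
move: E E'; move: (pderive _ _ p) (pderive _ _ p) (pderive _ _ p) (pderive _ _ p).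
move=> x1 x2 x3 x4 E E'; rewrite -E'.
by move/eqP: E; rewrite subr_eq => /eqP ->; rewrite opprB addrAC subrK addrC.
Qed.

End Dressing.

(** [C1_on] asserts continuity of the partial derivatives only; that of F follows from the same
    no-escape argument, here with a velocity already known to be continuous. *)
Lemma C1_on_mxcont {R : realType} (D : set (R * R)) k l
    (F : R * R -> 'M[R[i]]_(k, l)) : open D -> C1_on D F -> mxcont_on D F.
Proof.
move=> Do FC p Dp; have [dx dy cx cy] := FC p Dp.
apply: (@mxcvg_joint _ _ _ F (pderive dir_xi F) p (pderive dir_xi F p)).
- by apply: filterS (open_nbhs_nbhs (conj Do Dp)) => x /FC[].
- by split; [exact: dy|].
- apply: mxcvg_finer cx => P nP; exact: graph_nbhs_finer.
Qed.

Lemma C1_on_regular {R : realType} (D : set (R * R)) k l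
    (F : R * R -> 'M[R[i]]_(k, l)) : open D -> C1_on D F ->
  regular_on dir_xi D F /\ regular_on dir_eta D F.
Proof.
move=> Do FC; have cF := C1_on_mxcont Do FC.
split; split=> // p Dp; have [dx dy cx cy] := FC p Dp.
- exact: dx.
- exact: cx.
- exact: dy.
- exact: cy.
Qed.

Theorem theorem3p1 (R : realType) (m n : nat)
    (D : set (R * R)) (D_open : open D) (D_conn : connected D)
    (D0 : D (0, 0))
    (J : 'M[R[i]]_m)
    (J_unit : J \in unitmx) (J_herm : J = J^t*) (J_inv : J = invmx J)
    (alpha : R * R -> R) (f h : R -> R)
    (alphaE : forall p, D p -> alpha p = f p.1 + h p.2)
    (f_C1 : forall p, D p -> C1_at f p.1)
    (h_C1 : forall p, D p -> C1_at h p.2)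
    (alpha_neq0 : forall p, D p -> alpha p != 0)
    (u : R * R -> 'M[R[i]]_m)
    (u_eq : satisfies_eq D alpha u)
    (u0 : u (0, 0) = 1%:M) :
  let q : R * R -> 'M[R[i]]_m := fun p => logder dir_xi u p in
  let Q : R * R -> 'M[R[i]]_m := fun p => - logder dir_eta u p in
  forall (q_C1 : C1_on D q) (Q_C1 : C1_on D Q)
    (qJ : forall p, D p -> q p *m J = - (J *m (q p)^t*))
    (QJ : forall p, D p -> Q p *m J = - (J *m (Q p)^t*))
    (calA S0 : 'M[R[i]]_n) (Pi0 : 'M[R[i]]_(n, m))
    (S0_herm : S0 = S0^t*)
    (S0_id : calA *m S0 - S0 *m calA^t* = 'i *: (Pi0 *m J *m Pi0^t*))
    (A : R * R -> 'M[R[i]]_n) (Pi : R * R -> 'M[R[i]]_(n, m))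
    (S : R * R -> 'M[R[i]]_n)
    (A_init : A (0, 0) = calA) (Pi_init : Pi (0, 0) = Pi0)
    (S_init : S (0, 0) = S0)
    (AmI_unit : forall p, D p -> A p - 1%:M \in unitmx)
    (ApI_unit : forall p, D p -> A p + 1%:M \in unitmx),
  let a : R * R -> R[i] := fun p => (('D_dir_xi alpha p : R) / alpha p)%:C in
  let b : R * R -> R[i] := fun p => (('D_dir_eta alpha p : R) / alpha p)%:C in
  let Am : R * R -> 'M[R[i]]_n := fun p => invmx (A p - 1%:M) in
  let Ap : R * R -> 'M[R[i]]_n := fun p => invmx (A p + 1%:M) in
  let Ams : R * R -> 'M[R[i]]_n := fun p => invmx ((A p)^t* - 1%:M) in
  let Aps : R * R -> 'M[R[i]]_n := fun p => invmx ((A p)^t* + 1%:M) in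
  forall
    (A_xi : forall p, D p -> pderivable dir_xi A p /\
      pderive dir_xi A p =
        - a p *: A p - (2 * a p) *: 1%:M - (2 * a p) *: Am p)
    (A_eta : forall p, D p -> pderivable dir_eta A p /\
      pderive dir_eta A p =
        - b p *: A p + (2 * b p) *: 1%:M - (2 * b p) *: Ap p)
    (Pi_xi : forall p, D p -> pderivable dir_xi Pi p /\
      pderive dir_xi Pi p = Am p *m Pi p *m q p)
    (Pi_eta : forall p, D p -> pderivable dir_eta Pi p /\
      pderive dir_eta Pi p = Ap p *m Pi p *m Q p)
    (S_xi : forall p, D p -> pderivable dir_xi S p /\
      pderive dir_xi S p =
        a p *: (S p - 2 *: (Am p *m S p *m Ams p))
        - 'i *: (Am p *m Pi p *m q p *m J *m (Pi p)^t* *m Ams p))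
    (S_eta : forall p, D p -> pderivable dir_eta S p /\
      pderive dir_eta S p =
        b p *: (S p - 2 *: (Ap p *m S p *m Aps p))
        - 'i *: (Ap p *m Pi p *m Q p *m J *m (Pi p)^t* *m Aps p)),
  let G : set (R * R) :=
    [set p | [/\ D p, S p \in unitmx & A p \in unitmx]]%classic in
  let uhat : R * R -> 'M[R[i]]_m := fun p => darboux J A Pi S p *m u p in
  satisfies_eq G alpha uhat /\
  (forall p, G p -> (uhat p)^t* *m J *m uhat p = J).

Proof.
move=> q Q q_C1 Q_C1 qJ QJ calA S0 Pi0 S0_herm S0_id A Pi S A_init Pi_init S_init
  AmI_unit ApI_unit a b Am Ap Ams Aps A_xi A_eta Pi_xi Pi_eta S_xi S_eta.
(* This is - Q, the coefficient of the eta-system after the change of signs. *)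
pose r x := logder dir_eta u x.
have JJ : J *m J = 1%:M by rewrite {2}J_inv mulmxV.
have uu p : D p -> u p \in unitmx by move=> /u_eq[].
pose a' p := ('D_dir_xi alpha p : R) / alpha p.
pose b' p := ('D_dir_eta alpha p : R) / alpha p.
have flow_xi p : D p -> dressing_flow dir_xi J (q p) (a' p) A Pi S p.
  move=> Dp; split; [exact: AmI_unit|exact: qJ|exact: A_xi|exact: Pi_xi|exact: S_xi].
have flow_eta p : D p ->
    dressing_flow dir_eta J (r p) (b' p) (fun x => - A x) Pi (fun x => - S x) p.
  move=> Dp; have Qr : Q p = - r p by [].
  have BE : invmx (- A p - 1%:M) = - Ap p by rewrite -opprD invmx_opp.
  have BsE : invmx ((- A p)^t* - 1%:M) = - Aps p by rewrite ctrmxN -opprD invmx_opp.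
  split; rewrite ?BE ?BsE.
  - by rewrite -opprD unitmx_opp; exact: ApI_unit.
  - have := QJ p Dp; rewrite Qr ctrmxN mulmxN mulNmx; exact: oppr_inj.
  - apply: is_pderive_eq (is_pderiveN (A_eta p Dp)) _; exact: reflect_flow_A.
  - apply: is_pderive_eq (Pi_eta p Dp) _.
    by rewrite Qr mulmxN !mulNmx.
  - apply: is_pderive_eq (is_pderiveN (S_eta p Dp)) _.
    by rewrite Qr; exact: reflect_flow_S.
have a'E p (Dp : D p) : a' p = derive1 f p.1 / alpha p.
  by have [_ E] := is_derive_separated_xi D_open alphaE f_C1 Dp; rewrite /a' E.
have b'E p (Dp : D p) : b' p = derive1 h p.2 / alpha p.
  by have [_ E] := is_derive_separated_eta D_open alphaE h_C1 Dp; rewrite /b' E.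
have aa p (Dp : D p) : alpha p * a' p = derive1 f p.1.
  by rewrite a'E // mulrC divfK ?alpha_neq0.
have ab p (Dp : D p) : alpha p * b' p = derive1 h p.2.
  by rewrite b'E // mulrC divfK ?alpha_neq0.
have axi p (Dp : D p) : is_derive p dir_xi alpha (alpha p * a' p).
  by rewrite aa //; exact: (is_derive_separated_xi D_open alphaE f_C1 Dp).
have aeta p (Dp : D p) : is_derive p dir_eta alpha (alpha p * b' p).
  by rewrite ab //; exact: (is_derive_separated_eta D_open alphaE h_C1 Dp).
have nearD p (Dp : D p) : \forall x \near p, D x.
  exact: open_nbhs_nbhs (conj D_open Dp).
have alpha_cvg p (Dp : D p) : alpha @ p --> alpha p.
  exact: (cvg_separated D_open alphaE f_C1 h_C1 Dp).
have a_cont p (Dp : D p) : a' @ p --> a' p.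
  rewrite a'E //; apply: (@cvg_trans _ ((fun x => derive1 f x.1 / alpha x) @ p)).
    by apply: near_eq_cvg; apply: filterS (nearD p Dp) => x /a'E.
  have c1 := cvg_compose_fst (f_C1 p Dp).2.
  exact: (cvgM c1 (cvgV (alpha_neq0 p Dp) (alpha_cvg p Dp))).
have b_cont p (Dp : D p) : b' @ p --> b' p.
  rewrite b'E //; apply: (@cvg_trans _ ((fun x => derive1 h x.2 / alpha x) @ p)).
    by apply: near_eq_cvg; apply: filterS (nearD p Dp) => x /b'E.
  have c1 := cvg_compose_snd (h_C1 p Dp).2.
  exact: (cvgM c1 (cvgV (alpha_neq0 p Dp) (alpha_cvg p Dp))).
have a_reg : regular_on dir_eta D (fun x => ((alpha x * a' x)%:C)%:M : 'M[R[i]]_m).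
  by apply: (eq_regular D_open _ (regular_derive_fst D_open f_C1 m)) => p /aa ->.
have b_reg : regular_on dir_xi D (fun x => ((alpha x * b' x)%:C)%:M : 'M[R[i]]_m).
  by apply: (eq_regular D_open _ (regular_derive_snd D_open h_C1 m)) => p /ab ->.
have [_ q_reg] := C1_on_regular D_open q_C1.
have q_cont := C1_on_mxcont D_open q_C1.
have r_cont : mxcont_on D r.
  have Q_cont := C1_on_mxcont D_open Q_C1.
  apply: (eq_mxcont_on D_open _ (fun p Dp => mxcvgN (Q_cont p Dp))) => p _.
  exact: opprK.
have r_reg : regular_on dir_xi D r.
  have [Q_reg _] := C1_on_regular D_open Q_C1.
  by apply: (eq_regular D_open _ (regularN D_open Q_reg)) => p _; exact: opprK.
have u_xi p (Dp : D p) : is_pderive dir_xi u p (q p *m u p).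
  have [up [ux _] _ _] := u_eq p Dp; split => //.
  by rewrite /q /logder mulmxKV.
have u_eta p (Dp : D p) : is_pderive dir_eta u p (r p *m u p).
  have [up [_ uy] _ _] := u_eq p Dp; split => //.
  by rewrite /r /logder mulmxKV.
have u_mixed p (Dp : D p) : pderive dir_eta (fun x => (alpha x)%:C *: q x) p
    + pderive dir_xi (fun x => (alpha x)%:C *: r x) p = 0.
  by have [_ _ _] := u_eq p Dp.
have S0h : S (0, 0) = (S (0, 0))^t* by rewrite S_init.
have Syl0 : A (0, 0) *m S (0, 0) - S (0, 0) *m (A (0, 0))^t* =
    'i *: (Pi (0, 0) *m J *m (Pi (0, 0))^t*) by rewrite A_init S_init Pi_init.
have alpha_xi := regular_separated_xi D_open alphaE f_C1 h_C1 m.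
have alpha_eta := regular_separated_eta D_open alphaE f_C1 h_C1 m.
split.
  exact: (uhat_satisfies_eq D_open D_conn D0 J_herm JJ flow_xi flow_eta alpha_neq0
    axi aeta S0h Syl0 a_cont b_cont q_cont r_cont u_xi u_eta u0
    alpha_xi alpha_eta a_reg b_reg q_reg r_reg u_mixed).
move=> p Gp.
exact: (uhat_isometry D_open D_conn D0 J_herm JJ flow_xi flow_eta alpha_neq0
    axi aeta S0h Syl0 u_xi u_eta u0 Gp).
Qed.
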